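(* Let $\alpha: G \curvearrowright \mathcal{A}$ be a (pointwise) inner action of a finite group $G$ on a unital simple $C^*$-algebra $\mathcal{A}$. Fix any projective representation $w: G \to U(\mathcal{A})$ such that $\alpha_g = \operatorname{Ad}(w_g)$ for all $g \in G$. Then the following statements hold: (i) $\mathcal{A}^G \subseteq \mathcal{A}$ has a unique pseudo-expectation $\iff$ $w_g w_h = w_h w_g$ for all $g, h \in G$. (ii) $\mathcal{A} \rtimes_{\alpha,r} G \subseteq \mathcal{A} \otimes B(\ell^2(G))$ has a unique pseudo-expectation $\iff$ $G$ is abelian and $w_g w_h = w_h w_g$ for all $g, h \in G$ $\iff$ $G$ is abelian and there exists a (genuine) representation $u: G \to U(\mathcal{A})$ such that $\alpha_g = \operatorname{Ad}(u_g)$ for all $g \in G$. In particular, if $\mathcal{A} \rtimes_{\alpha,r} G \subseteq \mathcal{A} \otimes B(\ell^2(G))$ has a unique pseudo-expectation, then so does $\mathcal{A}^G \subseteq \mathcal{A}$.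
   Context: An action $\alpha: G \curvearrowright \mathcal{A}$ is a homomorphism $\alpha: G \to \operatorname{Aut}(\mathcal{A})$, $g \mapsto \alpha_g$. $U(\mathcal{A})$ is the unitary group of $\mathcal{A}$, and $\operatorname{Ad}(u)(a) = uau^*$. The action is (pointwise) inner if for every $g \in G$ there exists $w_g \in U(\mathcal{A})$ with $\alpha_g = \operatorname{Ad}(w_g)$. A map $w: G \to U(\mathcal{A})$ is a projective representation if $w_g w_h = \sigma(g,h) w_{gh}$ for all $g,h \in G$, where $\sigma: G \times G \to \mathbb{T}$ is a 2-cocycle; a (genuine) representation is a group homomorphism $G \to U(\mathcal{A})$. $\mathcal{A}^G = \{a \in \mathcal{A} : \alpha_g(a) = a \ \forall g \in G\}$. For $G$ finite, the reduced crossed product $\mathcal{A} \rtimes_{\alpha,r} G$ is identified with the $C^*$-subalgebra of $\mathcal{A} \otimes B(\ell^2(G))$ generated by the elements $\sum_{g} \alpha_g^{-1}(a) \otimes E_{g,g}$ ($a \in \mathcal{A}$) and $1 \otimes \lambda_g$ ($g \in G$), where $\lambda$ is the left regular representation and $E_{g,h} \in B(\ell^2(G))$ is the rank-one operator (matrix unit) with $E_{g,h}\delta_h = \delta_g$. For an inclusion $\mathcal{C} \subseteq \mathcal{B}$ of unital $C^*$-algebras with common unit, a pseudo-expectation is a unital completely positive map $\Psi: \mathcal{B} \to I(\mathcal{C})$ with $\Psi(c) = c$ for all $c \in \mathcal{C}$, where $I(\mathcal{C})$ is the (Hamana) injective envelope of $\mathcal{C}$ (the unique minimal injective operator system containing $\mathcal{C}$;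 it is a $C^*$-algebra containing $\mathcal{C}$ as a $C^*$-subalgebra). *)

(* Defs.v *)
(* MathComp / MathComp-Analysis development; the complex numbers are R[i]
   for an arbitrary R : realType. *)
From HB Require Import structures.
From mathcomp Require Import all_boot all_order all_algebra fingroup.
From mathcomp Require Import complex.
From mathcomp Require Import classical_sets functions reals topology normedtype.

Set Implicit Arguments.
Unset Strict Implicit.
Unset Printing Implicit Defensive.

Import Order.TTheory GRing.Theory Num.Theory.
Import numFieldNormedType.Exports.

Local Open Scope classical_set_scope.
Local Open Scope ring_scope.
Local Open Scope complex_scope.

(* A normed module that is also a ring is not a joinable structure in this
   hierarchy (the only join of normed modules and rings is numDomainType), so
   the norm and its completeness are part of the structure. MathComp's unital
   algebras satisfy 1 != 0: C*-algebras are nonzero. *)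

HB.mixin Record Algebra_isCStarAlgebra (R : realType) A
    of GRing.Algebra R[i] A := {
  star : A -> A;
  starK : involutive star;
  starD : {morph star : x y / x + y};
  starZ : forall (c : R[i]) x, star (c *: x) = Num.conj c *: star x;
  starM : forall x y, star (x * y) = star y * star x;
  cnorm : A -> R;
  cnormD : forall x y, cnorm (x + y) <= cnorm x + cnorm y;
  cnormZ : forall (c : R[i]) x, cnorm (c *: x) = complex.Re `|c| * cnorm x;
  cnorm0_eq0 : forall x, cnorm x = 0 -> x = 0;
  cnormM : forall x y, cnorm (x * y) <= cnorm x * cnorm y;
  cnorm_complete : forall u : nat -> A,
    (forall e : R, 0 < e -> exists N : nat, forall m n : nat,
       (N <= m)%N -> (N <= n)%N -> cnorm (u m - u n) < e) ->
    exists l : A, cnorm (u n - l) @[n --> \oo] --> (0 : R);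
  cstar_identity : forall x, cnorm (star x * x) = cnorm x ^+ 2
}.

#[short(type="cstarAlgType")]
HB.structure Definition CStarAlgebra (R : realType) :=
  {A of GRing.Algebra R[i] A & Algebra_isCStarAlgebra R A}.

Section CStarAlgebras.
Variable R : realType.
Implicit Types A B D I : cstarAlgType R.

Definition unitary A (u : A) : Prop := star u * u = 1 /\ u * star u = 1.

Definition Ad A (u a : A) : A := u * a * star u.

Definition norm_closed A (S : set A) : Prop :=
  forall (u : nat -> A) (l : A), (forall n, S (u n)) ->
    cnorm (u n - l) @[n --> \oo] --> (0 : R) -> S l.

Definition closed_ideal A (J : set A) : Prop :=
  [/\ norm_closed J, J 0, (forall x y, J x -> J y -> J (x + y)),
      (forall a x, J x -> J (a * x)) & (forall a x, J x -> J (x * a))].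

Definition simple_cstar A : Prop :=
  forall J : set A, closed_ideal J -> J = [set 0] \/ J = setT.

Definition cstar_subalgebra A (S : set A) : Prop :=
  [/\ norm_closed S,
      S 0 /\ (forall (c : R[i]) x y, S x -> S y -> S (c *: x + y)),
      (forall x y, S x -> S y -> S (x * y)) &
      (forall x, S x -> S (star x))].

Definition cstar_generated A (X : set A) : set A :=
  [set a | forall S : set A, cstar_subalgebra S -> X `<=` S -> S a].

(* A map defined on a subset S is a total function whose values outside of S
   are irrelevant. *)
Definition unital_star_hom_on A B (S : set A) (f : A -> B) : Prop :=
  [/\ f 1 = 1,
      (forall (c : R[i]) x y, S x -> S y -> f (c *: x + y) = c *: f x + f y),
      (forall x y, S x -> S y -> f (x * y) = f x * f y) &
      (forall x, S x -> f (star x) = star (f x))].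

Definition star_automorphism A (f : A -> A) : Prop :=
  unital_star_hom_on setT f /\ bijective f.

(* M_n(A) is a C*-algebra under the conjugate transpose, and its positive
   elements are exactly those of the form Y^* Y. *)

Definition mxstar A n (M : 'M[A]_n) : 'M[A]_n := (map_mx star M)^T.

Definition mxpositive A n (M : 'M[A]_n) : Prop :=
  exists Y : 'M[A]_n, M = mxstar Y *m Y.

(* By the Choi-Effros theorem every operator system occurs, up to unital
   complete order isomorphism, as a subset of a C*-algebra. *)
Definition operator_system A (S : set A) : Prop :=
  [/\ S 1,
      (forall (c : R[i]) x y, S x -> S y -> S (c *: x + y)) &
      (forall x, S x -> S (star x))].

Definition ucp_on A B (S : set A) (T : set B) (f : A -> B) : Prop :=
  [/\ f 1 = 1,
      (forall x, S x -> T (f x)),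
      (forall (c : R[i]) x y, S x -> S y -> f (c *: x + y) = c *: f x + f y) &
      (forall n (M : 'M[A]_n), (forall i j, S (M i j)) ->
         mxpositive M -> mxpositive (map_mx f M))].

Definition injective_operator_system A (S : set A) : Prop :=
  operator_system S /\
  forall (D : cstarAlgType R) (E F : set D),
    operator_system E -> operator_system F -> E `<=` F ->
    forall f : D -> A, ucp_on E S f ->
    exists g : D -> A, ucp_on F S g /\ (forall x, E x -> g x = f x).

(* (I, j) is an injective envelope of the unital C*-subalgebra C of B. *)
Definition injective_envelope B (C : set B) I (j : B -> I) : Prop :=
  [/\ unital_star_hom_on C j,
      set_inj C j,
      injective_operator_system [set: I] &
      (forall S : set I, injective_operator_system S -> j @` C `<=` S ->
         S = [set: I])].

Definition pseudo_expectation B (C : set B) I (j : B -> I) (Psi : B -> I) :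
    Prop :=
  ucp_on [set: B] [set: I] Psi /\ (forall c, C c -> Psi c = j c).

Definition unique_pseudo_expectation B (C : set B) I (j : B -> I) : Prop :=
  exists! Psi : B -> I, pseudo_expectation C j Psi.

Section Actions.
Variable G : finGroupType.

Definition is_action A (alpha : G -> A -> A) : Prop :=
  (forall g, star_automorphism (alpha g)) /\
  (forall g h a, alpha (g * h)%g a = alpha g (alpha h a)).

Definition inner_action A (alpha : G -> A -> A) : Prop :=
  forall g, exists2 w : A, unitary w & alpha g =1 Ad w.

Definition fixed_points A (alpha : G -> A -> A) : set A :=
  [set a | forall g, alpha g a = a].

Definition circle_cocycle (sigma : G -> G -> R[i]) : Prop :=
  (forall g h, `|sigma g h| = 1) /\
  (forall g h k,
     sigma g h * sigma (g * h)%g k = sigma g (h * k)%g * sigma h k).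

Definition projective_representation A (w : G -> A) : Prop :=
  (forall g, unitary (w g)) /\
  exists2 sigma : G -> G -> R[i], circle_cocycle sigma &
    forall g h, w g * w h = sigma g h *: w (g * h)%g.

Definition unitary_representation A (u : G -> A) : Prop :=
  (forall g, unitary (u g)) /\ (forall g h, u (g * h)%g = u g * u h).

(* B(l^2(G)): matrices indexed by G through enum_rank. *)
Definition Bl2 : Type := 'M[R[i]]_#|G|.

Definition Eunit (g h : G) : Bl2 := delta_mx (enum_rank g) (enum_rank h).

(* lambda_g delta_h = delta_(g h) *)
Definition left_regular (g : G) : Bl2 := \sum_(h : G) Eunit (g * h)%g h.

(* D, with elementary tensors t a x = a (x) x, is the C*-algebra A (x) B(l^2(G)):
   t induces a *-isomorphism from the algebraic tensor product (complete, as
   B(l^2(G)) is finite-dimensional) onto D. The last clause says that the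
   induced linear map is bijective, the matrix units being a basis of
   B(l^2(G)). The norm of D is then determined, since C*-norms are unique. *)
Definition tensor_Bl2 A D (t : A -> Bl2 -> D) : Prop :=
  [/\ (forall (c : R[i]) a b x, t (c *: a + b) x = c *: t a x + t b x),
      (forall (c : R[i]) a (x y : Bl2),
         t a (c *: x + y : 'M_#|G|) = c *: t a x + t a y),
      (forall a b (x y : Bl2), t a x * t b y = t (a * b) (x *m y)) &
      [/\ (forall a (x : Bl2), star (t a x) = t (star a) (map_mx Num.conj x)^T),
          t 1 1%:M = 1 &
          forall d : D, exists! c : {ffun G * G -> A},
            d = \sum_(p : G * G) t (c p) (Eunit p.1 p.2)]].

Definition crossed_product A (alpha : G -> A -> A) D (t : A -> Bl2 -> D) :
    set D :=
  cstar_generated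
    ([set \sum_(g : G) t (alpha g^-1%g a) (Eunit g g) | a in [set: A]] `|`
     [set t 1 (left_regular g) | g in [set: G]]).

End Actions.
End CStarAlgebras.

(* Main.v *)
(** The fixed-point algebra A^G is the commutant of w in A, and the crossed product is the
    commutant in D of the projective representation [k |-> w_k (x) rho_k], [rho] being the right
    regular representation.  So everything reduces to one statement: for a projective unitary
    representation v of a finite group in a C*-algebra B, with commutant C, the inclusion of C in
    B has a unique pseudo-expectation iff the v_g commute.

    If they commute, each v_g lies in C and is central there.  The fixed points in I(C) of the
    averaging over the Ad(v_g) form an injective operator system containing C, hence all of I(C)
    by minimality, so the v_g are central in I(C).  As they lie in the multiplicative domain of
    any pseudo-expectation Psi, Psi is invariant under the Ad(v_g) and factors through the average
    E.  Conversely, E can be twisted for u = c v_h and u' = v_k u v_k^* into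
    [x |-> E((1 + u)^* x (1 + u) + (1 - u')^* x (1 - u')) / 4], again a completely positive
    projection onto C; it equals E only if u + u^* = u' + u'^*, which for c = 1, i gives
    v_h = v_k v_h v_k^*.

    Positivity is handled without spectral theory: h = h^* is positive when |t - h| <= t for some
    t, square roots are limits of a polynomial iteration, and this iteration also converges for
    matrices because the powers of a matrix between 0 and 1 have bounded entries. *)
Require Import Defs.
From mathcomp Require Import all_boot all_order all_algebra fingroup.
From mathcomp Require Import complex.
From mathcomp Require Import boolp classical_sets functions reals topology normedtype.
From mathcomp Require Import sequences ring lra spectral.

Set Implicit Arguments.
Unset Strict Implicit.
Unset Printing Implicit Defensive.

Import Order.TTheory GRing.Theory Num.Theory.
Import numFieldNormedType.Exports.
Local Open Scope classical_set_scope.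
Local Open Scope ring_scope.
Local Open Scope complex_scope.

(** * Norm, involution and limits in a C*-algebra *)

Section CStarNorm.
Variables (R : realType) (A : cstarAlgType R).
Implicit Types (x y z : A) (c : R[i]) (r : R).

Definition tends (u : nat -> A) (l : A) : Prop :=
  cnorm (u n - l) @[n --> \oo] --> (0 : R).

Lemma Re_norm_real r : complex.Re `|r%:C| = `|r|.
Proof. by rewrite normc_def /= expr0n addr0 sqrtr_sqr. Qed.

Lemma conj_real r : Num.conj r%:C = r%:C.
Proof. by apply/CrealP/complex_realP; exists r. Qed.

Lemma conj_unit c : `|c| = 1 -> Num.conj c * c = 1.
Proof. by move=> c1; rewrite mulrC -normCK c1 expr1n. Qed.

Lemma mulCii : 'i%C * 'i%C = -1 :> R[i].
Proof. by rewrite -expr2 sqr_i. Qed.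

Lemma conjCi : Num.conj 'i%C = - 'i%C :> R[i].
Proof.
have n1 : `|'i%C : R[i]| = 1 by rewrite normc_def /= expr0n expr1n add0r sqrtr1.
have /(congr1 ( *%R^~ 'i%C)) := conj_unit n1.
by rewrite -mulrA mulCii mulrN1 mul1r => h; apply: oppr_inj; rewrite opprK.
Qed.

Lemma cnorm0 : cnorm (0 : A) = 0.
Proof. by rewrite -(scale0r (0 : A)) cnormZ normr0 mul0r. Qed.

Lemma cnormN x : cnorm (- x) = cnorm x.
Proof. by rewrite -scaleN1r cnormZ normrN normr1 mul1r. Qed.

Lemma cnormB x y : cnorm (x - y) = cnorm (y - x).
Proof. by rewrite -cnormN opprB. Qed.

Lemma cnorm_ge0 x : 0 <= cnorm x.
Proof.
have := cnormD x (- x); rewrite subrr cnorm0 cnormN.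
by rewrite -mulr2n pmulrn_lge0.
Qed.

Lemma cnormZr r x : 0 <= r -> cnorm (r%:C *: x) = r * cnorm x.
Proof. by move=> r0; rewrite cnormZ Re_norm_real ger0_norm. Qed.

Lemma star0 : star (0 : A) = 0.
Proof. by rewrite -(scale0r (0 : A)) starZ conjC0 !scale0r. Qed.

Lemma starN x : star (- x) = - star x.
Proof. by rewrite -scaleN1r starZ rmorphN1 scaleN1r. Qed.

Lemma starB x y : star (x - y) = star x - star y.
Proof. by rewrite starD starN. Qed.

Lemma star1 : star (1 : A) = 1.
Proof. by rewrite -[LHS]mul1r -{1}[1]starK -starM mul1r starK. Qed.

Lemma starZr r x : star (r%:C *: x) = r%:C *: star x.
Proof. by rewrite starZ conj_real. Qed.

Lemma star_sum (I : Type) (s : seq I) (P : pred I) (f : I -> A) :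
  star (\sum_(i <- s | P i) f i) = \sum_(i <- s | P i) star (f i).
Proof. by apply: (big_morph (@star R A) (@starD R A) star0). Qed.

Lemma half_double x : (2^-1 : R)%:C *: (x + x) = x.
Proof.
rewrite scalerDr -scalerDl -rmorphD /=; have -> : 2^-1 + 2^-1 = 1 :> R by lra.
by rewrite scale1r.
Qed.

Lemma starX x n : star (x ^+ n) = star x ^+ n.
Proof. by elim: n => [|n IH]; rewrite ?star1 // exprS starM IH exprSr. Qed.

(** Submultiplicativity in [|y|^2 = |y^* y|] gives [|y| <= |y^*|]; this is used for [x] and for
    [star x]. *)
Lemma cnorm_star x : cnorm (star x) = cnorm x.
Proof.
have le y : cnorm y <= cnorm (star y).
  have := cnormM (star y) y; rewrite cstar_identity expr2.
  have [->|ny] := eqVneq (cnorm y) 0; first by rewrite cnorm_ge0.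
  by rewrite ler_pM2r // lt_def ny cnorm_ge0.
by apply/eqP; rewrite eq_le le -{2}[x]starK le.
Qed.

(** The C*-identity at 1 makes the norm a root of [r = r^2], and it is nonzero because [1 != 0]. *)
Lemma cnorm1 : cnorm (1 : A) = 1.
Proof.
have := cstar_identity (1 : A); rewrite star1 mul1r expr2 => /eqP.
rewrite -subr_eq0 -{1}[cnorm 1]mulr1 -mulrBr mulf_eq0 subr_eq0.
by move=> /orP[/eqP/cnorm0_eq0/eqP|/eqP //]; rewrite oner_eq0.
Qed.

Lemma cnorm_sa x : star x = x -> cnorm (x * x) = cnorm x ^+ 2.
Proof. by move=> hx; rewrite -[RHS]cstar_identity hx. Qed.

Lemma cnorm_sa_exp2 x m : star x = x -> cnorm (x ^+ (2 ^ m)) = cnorm x ^+ (2 ^ m).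
Proof.
move=> hx; elim: m => [|m IH]; first by rewrite !expr1.
by rewrite expnS mulnC !exprM expr2 cnorm_sa ?starX ?hx // IH.
Qed.

Lemma cnormX_le1 x n : cnorm x <= 1 -> cnorm (x ^+ n) <= 1.
Proof.
move=> hx; elim: n => [|n IH]; first by rewrite expr0 cnorm1.
rewrite exprS (le_trans (cnormM _ _)) //.
by rewrite -[leRHS]mulr1 ler_pM ?cnorm_ge0.
Qed.

Lemma star_mul_eq0 x : star x * x = 0 -> x = 0.
Proof.
move=> h; apply: cnorm0_eq0; apply/eqP; rewrite -sqrf_eq0.
by rewrite -cstar_identity h cnorm0.
Qed.

Lemma sa_sqr_eq0 x : star x = x -> x * x = 0 -> x = 0.
Proof. by move=> hx h; apply: star_mul_eq0; rewrite hx. Qed.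

Lemma tends_le (u : nat -> A) (x : A) (g : nat -> R) :
  (forall n, cnorm (u n - x) <= g n) ->
  g n @[n --> \oo] --> (0 : R) -> tends u x.
Proof.
move=> h gl; apply: (squeeze_cvgr _ (cvg_cst (0 : R)) gl).
by apply: nearW => n; rewrite cnorm_ge0 h.
Qed.

Lemma tends_cst x : tends (fun=> x) x.
Proof.
apply: (@tends_le _ _ (fun=> 0)) => [n|]; last exact: cvg_cst.
by rewrite subrr cnorm0.
Qed.

Lemma tendsD u v x y : tends u x -> tends v y -> tends (fun n => u n + v n) (x + y).
Proof.
move=> hu hv.
apply: (@tends_le _ _ (fun n => cnorm (u n - x) + cnorm (v n - y))) => [n|].
  by rewrite opprD addrACA cnormD.
have -> : 0 = 0 + 0 :> R by rewrite addr0.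
by apply: cvgD.
Qed.

Lemma tendsZ c u x : tends u x -> tends (fun n => c *: u n) (c *: x).
Proof.
move=> hu.
apply: (@tends_le _ _ (fun n => complex.Re `|c| * cnorm (u n - x))) => [n|].
  by rewrite -scalerBr cnormZ.
have -> : 0 = complex.Re `|c| * 0 :> R by rewrite mulr0.
by apply: cvgM => //; apply: cvg_cst.
Qed.

Lemma tendsN u x : tends u x -> tends (fun n => - u n) (- x).
Proof.
move=> hu; apply: (@tends_le _ _ (fun n => cnorm (u n - x))) => // n.
by rewrite -opprD cnormN.
Qed.

Lemma tendsM u v x y : tends u x -> tends v y -> tends (fun n => u n * v n) (x * y).
Proof.
move=> hu hv.
apply: (@tends_le _ _ (fun n => cnorm (u n - x) * cnorm (v n - y)
   + (cnorm (u n - x) * cnorm y + cnorm x * cnorm (v n - y)))) => [n|].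
  have -> : u n * v n - x * y =
     (u n - x) * (v n - y) + ((u n - x) * y + x * (v n - y)).
    by rewrite addrA -mulrDr subrK mulrBl mulrBr addrA subrK.
  apply: (le_trans (cnormD _ _)); apply: lerD; first exact: cnormM.
  by apply: (le_trans (cnormD _ _)); apply: lerD; apply: cnormM.
have -> : 0 = 0 * 0 + (0 * cnorm y + cnorm x * 0) :> R by rewrite !mulr0 mul0r !addr0.
by apply: cvgD; [apply: cvgM | apply: cvgD; apply: cvgM => //; apply: cvg_cst].
Qed.

Lemma tends_star u x : tends u x -> tends (fun n => star (u n)) (star x).
Proof.
move=> hu; apply: (@tends_le _ _ (fun n => cnorm (u n - x))) => // n.
by rewrite -starB cnorm_star.
Qed.

Lemma tends_sum (I : Type) (s : seq I) (u : I -> nat -> A) (x : I -> A) :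
  (forall i, tends (u i) (x i)) ->
  tends (fun n => \sum_(i <- s) u i n) (\sum_(i <- s) x i).
Proof.
move=> h; elim: s => [|i s IH].
  by rewrite big_nil; under eq_fun do rewrite big_nil; apply: tends_cst.
by rewrite big_cons; under eq_fun do rewrite big_cons; apply: tendsD.
Qed.

Lemma tendsS u x : tends u x -> tends (fun n => u n.+1) x.
Proof. by move=> hu; rewrite /tends (cvg_shiftS (fun n => cnorm (u n - x))). Qed.

Lemma tends_unique u x y : tends u x -> tends u y -> x = y.
Proof.
move=> hx hy; apply/eqP; rewrite -subr_eq0; apply/eqP; apply: cnorm0_eq0.
have := tendsD hx (tendsN hy); rewrite /tends.
under eq_cvg do rewrite subrr sub0r cnormN.
by move=> h; apply: (cvg_unique _ (cvg_cst _) h).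
Qed.

Lemma tends_norm_le u x r : tends u x -> (forall n, cnorm (u n) <= r) -> cnorm x <= r.
Proof.
move=> hu h; have H : (fun n => r + cnorm (u n - x)) @ \oo --> r.
  by rewrite -[X in _ --> X]addr0; apply: cvgD => //; apply: cvg_cst.
apply: (cvgr_to_ge H).
apply: nearW => n; rewrite -[x in cnorm x <= _](subKr (u n)).
apply: (le_trans (cnormD _ _)); rewrite cnormN; exact: lerD.
Qed.

End CStarNorm.

(** * Square roots by polynomial iteration *)

(* [1 - sqrt (1 - s)] is the limit of the iteration [x |-> (s + x ^ 2) / 2] started at 0; the
   same iteration of real numbers, at [s = 1], majorizes it. *)
Section SquareRootIteration.
Variables (R : realType).

Fixpoint sqrt_scalar (m : nat) : R :=
  if m is m'.+1 then (1 + sqrt_scalar m' ^+ 2) / 2 else 0.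

Lemma sqrt_scalar_bounds m : 0 <= sqrt_scalar m <= 1.
Proof.
elim: m => [|m /andP[h0 h1]]; first by rewrite lexx ler01.
rewrite [sqrt_scalar _]/=; move: (sqrt_scalar m) h0 h1 => b h0 h1.
have : b ^+ 2 <= 1 by rewrite expr_le1.
have := sqr_ge0 b; lra.
Qed.

(** The sequence is bounded by 1 and nondecreasing, since [(1 + b^2) / 2 - b = (1 - b)^2 / 2]. *)
Lemma sqrt_scalar_cauchy (e : R) : 0 < e -> exists N, forall m n,
  (N <= m)%N -> (m <= n)%N -> `|sqrt_scalar n - sqrt_scalar m| < e.
Proof.
move=> e0; have cv : cvgn sqrt_scalar.
  apply: nondecreasing_is_cvgn.
    apply/nondecreasing_seqP => m; rewrite [leRHS]/=.
    have := sqr_ge0 (sqrt_scalar m - 1); rewrite sqrrB1; lra.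
  by exists 1 => _ [m _ <-]; have /andP[] := sqrt_scalar_bounds m.
have e2 : 0 < e / 2 by rewrite divr_gt0.
have /cvgrPdist_lt /(_ _ e2) [N _ hN] := cv.
exists N => m n hm hn.
have h1 := hN m hm; have h2 := hN n (leq_trans hm hn).
rewrite -(subrK (limn sqrt_scalar) (sqrt_scalar n)) -addrA.
apply: (le_lt_trans (ler_normD _ _)); rewrite [X in X + _]distrC; lra.
Qed.

Variables (A : cstarAlgType R) (n : nat) (S : 'M[A]_n).
Implicit Types (M : 'M[A]_n) (r : R).

(** Matrices over [A] are scaled by elements of [A], so the scalar 1/2 enters as a multiple of the
    unit. *)
Let half : A := ((2^-1 : R)%:C)%:A.

Fixpoint sqrt_mx (m : nat) : 'M[A]_n :=
  if m is m'.+1 then half *: (S + sqrt_mx m' * sqrt_mx m') else 0.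

(** Polynomials in [S] with nonnegative coefficients of sum [r]. They are closed under products, and
    a common bound on the entries of the powers of [S] bounds their entries by [r] times as much. *)
Inductive power_comb : R -> 'M[A]_n -> Prop :=
| PowerComb0 : power_comb 0 0
| PowerCombX k : power_comb 1 (S ^+ k)
| PowerCombD r1 r2 M1 M2 : power_comb r1 M1 -> power_comb r2 M2 ->
    power_comb (r1 + r2) (M1 + M2)
| PowerCombH r M : power_comb r M -> power_comb (r / 2) (half *: M).

Lemma alg_scalemxAr (c : R[i]) (M N : 'M[A]_n) : M * ((c%:A : A) *: N) = (c%:A : A) *: (M * N).
Proof.
apply/matrixP => i j; rewrite !mxE mulr_sumr; apply: eq_bigr => k _.
by rewrite !mxE !mulr_algl -scalerAr.
Qed.

Lemma alg_scalemxA (c d : R[i]) (M : 'M[A]_n) :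
  (c%:A : A) *: ((d%:A : A) *: M) = ((c * d)%:A : A) *: M.
Proof. by rewrite scalerA mulr_algl scalerA. Qed.

Lemma power_combM r1 r2 M1 M2 :
  power_comb r1 M1 -> power_comb r2 M2 -> power_comb (r1 * r2) (M1 * M2).
Proof.
move=> h1 h2; elim: h1 => {r1 M1} [|k|r1 r1' M1 M1' _ IH1 _ IH2|r1 M1 _ IH].
- by rewrite !mul0r; apply: PowerComb0.
- rewrite mul1r; elim: h2 => {r2 M2} [|l|r2 r2' M2 M2' _ IH1 _ IH2|r2 M2 _ IH].
  + by rewrite mulr0; apply: PowerComb0.
  + by rewrite -exprD; apply: PowerCombX.
  + by rewrite mulrDr; apply: PowerCombD.
  + by rewrite alg_scalemxAr; apply: PowerCombH.
- by rewrite !mulrDl; apply: PowerCombD.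
- have -> : half *: M1 * M2 = half *: (M1 * M2) by rewrite /GRing.mul /= scalemxAl.
  by rewrite mulrAC; apply: PowerCombH.
Qed.

Lemma power_comb_sqrt m : power_comb (sqrt_scalar m) (sqrt_mx m).
Proof.
elim: m => [|m IH]; first exact: PowerComb0.
rewrite /=; apply: PowerCombH; apply: PowerCombD; first by rewrite -[S]expr1; apply: PowerCombX.
by rewrite expr2; apply: power_combM.
Qed.

(** Writing [x'^2 - x^2] as [(x' - x) x' + x (x' - x)] passes the nonnegativity of the coefficients
    from one increment to the next. *)
Lemma power_comb_sqrtS m :
  power_comb (sqrt_scalar m.+1 - sqrt_scalar m) (sqrt_mx m.+1 - sqrt_mx m).
Proof.
elim: m => [|m IH]; first by rewrite !subr0; apply: power_comb_sqrt.
set b' := sqrt_scalar m.+1 in IH *; set b := sqrt_scalar m in IH *.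
set x' := sqrt_mx m.+1 in IH *; set x := sqrt_mx m in IH *.
have -> : sqrt_scalar m.+2 - b' = ((b' - b) * b' + b * (b' - b)) / 2.
  have -> : sqrt_scalar m.+2 - b' = (1 + b' ^+ 2) / 2 - (1 + b ^+ 2) / 2 by [].
  by field.
have -> : sqrt_mx m.+2 - x' = half *: ((x' - x) * x' + x * (x' - x)).
  have -> : sqrt_mx m.+2 - x' = half *: (S + x' * x') - half *: (S + x * x) by [].
  rewrite -scalerBr; congr (_ *: _); rewrite mulrBl mulrBr addrA subrK.
  by rewrite opprD addrACA subrr add0r.
apply: PowerCombH; apply: PowerCombD; apply: power_combM => //; exact: power_comb_sqrt.
Qed.

Lemma power_comb_sqrtB m p : (m <= p)%N ->
  power_comb (sqrt_scalar p - sqrt_scalar m) (sqrt_mx p - sqrt_mx m).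
Proof.
move=> /subnK <-; elim: (p - m)%N => [|k IH].
  by rewrite !subrr; apply: PowerComb0.
rewrite addSn; have := PowerCombD (power_comb_sqrtS (k + m)) IH.
by rewrite !addrA !subrK.
Qed.

Variable kappa : R.
Hypothesis bounded_powers : forall k i j, cnorm ((S ^+ k) i j) <= kappa.

Lemma power_comb_norm r M i j : power_comb r M -> cnorm (M i j) <= r * kappa.
Proof.
elim=> {r M} [|k|r1 r2 M1 M2 _ h1 _ h2|r M _ h].
- by rewrite mxE cnorm0 mul0r.
- by rewrite mul1r.
- by rewrite mxE mulrDl (le_trans (cnormD _ _)) // lerD.
- rewrite mxE mulr_algl cnormZr ?invr_ge0 // mulrAC mulrC.
  by rewrite ler_pM2r ?invr_gt0.
Qed.

(** Increments have nonnegative coefficients, so their entries are at most [kappa] times the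
    increments of the scalar iteration, which is Cauchy. *)
Lemma sqrt_mx_cvg : exists B : 'M[A]_n, forall i j, tends (fun m => sqrt_mx m i j) (B i j).
Proof.
suff /choice [f fP] : forall ij : 'I_n * 'I_n,
    exists l, tends (fun m => sqrt_mx m ij.1 ij.2) l.
  by exists (\matrix_(i, j) f (i, j)) => i j; rewrite mxE; apply: (fP (i, j)).
case=> i j; apply: cnorm_complete => e e0 /=.
have k0 : 0 <= kappa by apply: le_trans (bounded_powers 0 i j); apply: cnorm_ge0.
(* The 1 covers the case [kappa = 0]. *)
have e1 : 0 < e / (kappa + 1) by rewrite divr_gt0 // ltr_wpDl.
have [N hN] := sqrt_scalar_cauchy e1; exists N.
have main m p : (N <= m)%N -> (m <= p)%N -> cnorm (sqrt_mx m i j - sqrt_mx p i j) < e.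
  move=> hm mp; have := power_comb_norm i j (power_comb_sqrtB mp); rewrite !mxE cnormB.
  move/le_lt_trans; apply; apply: le_lt_trans (ler_wpM2r k0 (ler_norm _)) _.
  apply: le_lt_trans (ler_wpM2l (normr_ge0 _) (_ : _ <= kappa + 1)) _; first by rewrite lerDl.
  by rewrite -ltr_pdivlMr ?ltr_wpDl //; apply: hN.
move=> m p hm hp; have [mp|/ltnW pm] := leqP m p; first exact: main.
by rewrite cnormB; apply: main.
Qed.

(** The clause on [Q] transfers to the limit every closed property kept by the iteration:
    self-adjointness, norm bounds, commutation, entries in a subalgebra. *)
Lemma sqrt_one_sub_mx : exists B : 'M[A]_n, (1 - B) * (1 - B) = 1 - S /\
  forall Q : set 'M[A]_n, Q 0 -> (forall M, Q M -> Q (half *: (S + M * M))) ->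
    (forall (u : nat -> 'M[A]_n) M, (forall m, Q (u m)) ->
       (forall i j, tends (fun m => u m i j) (M i j)) -> Q M) -> Q B.
Proof.
have [B hB] := sqrt_mx_cvg; exists B; split; last first.
  by move=> Q Q0 QS Ql; apply: (Ql _ _ _ hB) => m; elim: m => // m; apply: QS.
have {hB} E : B = half *: (S + B * B).
  apply/matrixP => i j; apply: (tends_unique (tendsS (hB i j))) => /=.
  under eq_fun do rewrite !mxE mulr_algl; rewrite !mxE mulr_algl.
  apply/tendsZ/tendsD; first exact: tends_cst.
  by apply: tends_sum => k; apply: tendsM.
(* The fixed-point equation [2 B = S + B^2] is a rearrangement of [(1 - B)^2 = 1 - S]. *)
have : B + B = S + B * B.
  rewrite [B in LHS]E -scalerDl /half -!scalerDl -rmorphD /=.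
  have -> : 2^-1 + 2^-1 = 1 :> R by lra.
  by rewrite !scale1r.
move=> E2; have -> : S = B + B - B * B by rewrite E2 addrK.
by rewrite mulrBr mulr1 mulrBl mul1r !opprB opprD !addrA; congr (_ - B); rewrite addrAC.
Qed.

End SquareRootIteration.

(** * Positive elements of a C*-algebra *)

Section Positivity.
Variables (R : realType) (A : cstarAlgType R).
Implicit Types (x y z a b h : A) (c : R[i]) (r t : R).

(** The case of 1 x 1 matrices: the powers of [s] stay in the unit ball. *)
Lemma sqrt_one_sub (s : A) : cnorm s <= 1 -> exists b : A, (1 - b) * (1 - b) = 1 - s /\
  forall Q : set A, Q 0 -> (forall x, Q x -> Q ((2^-1 : R)%:C *: (s + x * x))) ->
    (forall (u : nat -> A) x, (forall m, Q (u m)) -> tends u x -> Q x) -> Q b.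
Proof.
move=> s1; have sX k : (s%:M : 'M[A]_1) ^+ k = (s ^+ k)%:M.
  by elim: k => // k IH; rewrite !exprS IH [LHS]mul_scalar_mx scale_scalar_mx.
have bnd k (i j : 'I_1) : cnorm (((s%:M : 'M[A]_1) ^+ k) i j) <= 1.
  by rewrite sX !ord1 mxE cnormX_le1.
have [B [BB BQ]] := sqrt_one_sub_mx bnd.
exists (B 0 0); split.
  by move/matrixP/(_ 0 0): BB; rewrite !mxE big_ord1 !mxE.
move=> Q Q0 QS Ql; apply: (BQ (fun M => Q (M 0 0))) => [|M QM|u M uQ uM].
- by rewrite mxE.
- by rewrite !mxE big_ord1 mulr_algl; apply: QS.
- exact: (Ql (fun m => u m 0 0)).
Qed.

Lemma commrZ c z x : GRing.comm z x -> GRing.comm z (c *: x).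
Proof. by move=> zx; rewrite /GRing.comm -scalerAl -scalerAr zx. Qed.

Lemma sqrt_one_sub_sa (s : A) : star s = s -> cnorm s <= 1 -> exists b,
  [/\ star b = b, (1 - b) * (1 - b) = 1 - s, cnorm b <= 1 &
      forall z, GRing.comm z s -> GRing.comm z b].
Proof.
move=> ss ns; have [B [BB BQ]] := sqrt_one_sub ns; exists B; split=> //.
- apply: (BQ (fun x => star x = x)); first exact: star0.
    by move=> x sx; rewrite starZr starD starM ss sx.
  move=> u x us ux; apply: (tends_unique (tends_star ux)).
  by under eq_fun do rewrite us.
- apply: (BQ (fun x => cnorm x <= 1)); first by rewrite cnorm0.
    move=> x nx; rewrite cnormZr ?invr_ge0 // mulrC ler_pdivrMr // mul1r.
    apply: le_trans (cnormD _ _) _; have := cnormM x x; have := cnorm_ge0 x.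
    by move: ns nx; nra.
  by move=> u x us ux; apply: (tends_norm_le ux).
- move=> z zs; apply: (BQ (fun x => GRing.comm z x)); first exact: commr0.
    by move=> x zx; apply/commrZ/commrD => //; apply: commrM.
  move=> u x us ux; apply: (tends_unique (tendsM (tends_cst z) ux)).
  under eq_fun do rewrite us; exact: tendsM ux (tends_cst z).
Qed.

(* For self-adjoint [h], [cnorm (t - h) <= t] says that the spectrum of [h] lies in [[0, 2 t]]. *)
Definition cpos h : Prop := star h = h /\ exists t, cnorm (t%:C%:A - h) <= t.

Lemma star_alg c : star (c%:A : A) = (Num.conj c)%:A.
Proof. by rewrite starZ star1. Qed.

Lemma star_alg_real r : star (r%:C%:A : A) = r%:C%:A.
Proof. by rewrite star_alg conj_real. Qed.

Lemma cpos0 : cpos 0.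
Proof. by split; [exact: star0 | exists 0; rewrite scale0r subrr cnorm0]. Qed.

Lemma cposD h1 h2 : cpos h1 -> cpos h2 -> cpos (h1 + h2).
Proof.
move=> [s1 [t1 n1]] [s2 [t2 n2]]; split; first by rewrite starD s1 s2.
exists (t1 + t2); rewrite rmorphD /= scalerDl opprD addrACA.
by apply: le_trans (cnormD _ _) _; apply: lerD.
Qed.

Lemma cpos_sum (I : Type) (s : seq I) (P : pred I) (f : I -> A) :
  (forall i, P i -> cpos (f i)) -> cpos (\sum_(i <- s | P i) f i).
Proof.
by move=> h; apply: big_ind => //; [apply: cpos0 | apply: cposD].
Qed.

Lemma cposZ r h : 0 <= r -> cpos h -> cpos (r%:C *: h).
Proof.
move=> r0 [s [t n]]; split; first by rewrite starZr s.
exists (r * t); rewrite rmorphM /= -scalerA -scalerBr cnormZr //.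
exact: ler_wpM2l.
Qed.

Lemma cpos_norm h : star h = h -> cpos ((cnorm h)%:C%:A - h).
Proof.
by move=> s; split; [rewrite starB s star_alg_real | exists (cnorm h); rewrite subKr].
Qed.

(** After scaling, [s = 1 - h / t] has norm at most 1; if [(1 - b)^2 = 1 - s], then [sqrt t (1 - b)]
    is a root of [h]. The bound [|b| <= 1] makes this root positive, with constant [sqrt t]. *)
Lemma cpos_sqrt h : cpos h -> exists b,
  [/\ star b = b, b * b = h, cpos b & forall z, GRing.comm z h -> GRing.comm z b].
Proof.
case=> hs [t ht]; have t0 : 0 <= t := le_trans (cnorm_ge0 _) ht.
have [t00|tn0] := eqVneq t 0.
  have h0 : h = 0.
    apply: cnorm0_eq0; apply/eqP; rewrite eq_le cnorm_ge0 andbT.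
    by move: ht; rewrite t00 scale0r sub0r cnormN.
  by exists 0; rewrite h0 star0 mulr0; split=> //; apply: cpos0.
have tC : (t%:C : R[i]) != 0 by rewrite (inj_eq (@complexI R)).
pose s : A := 1 - (t^-1)%:C *: h.
have ns : cnorm s <= 1.
  have -> : s = (t^-1)%:C *: (t%:C%:A - h).
    by rewrite scalerBr scalerA -rmorphM mulVf // scale1r.
  by rewrite cnormZr ?invr_ge0 // ler_pdivrMl ?mulr1 // lt_def tn0.
have ss : star s = s by rewrite starB star1 starZr hs.
have [B [Bs BB Bn Bc]] := sqrt_one_sub_sa ss ns.
have r0 := sqrtr_ge0 t; have rr : Num.sqrt t * Num.sqrt t = t by rewrite -expr2 sqr_sqrtr.
exists ((Num.sqrt t)%:C *: (1 - B)); split.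
- by rewrite starZr starB star1 Bs.
- rewrite -scalerAl -scalerAr scalerA -rmorphM rr BB opprB addrC subrK.
  by rewrite scalerA -rmorphM divff // scale1r.
- split; first by rewrite starZr starB star1 Bs.
  exists (Num.sqrt t); rewrite -scalerBr subKr cnormZr //.
  by rewrite -[leRHS]mulr1 ler_wpM2l.
- move=> z zh; apply/commrZ/commrB; [exact: commr1 | apply: Bc].
  by apply: commrB; [exact: commr1 | exact: commrZ].
Qed.

(* [a + i b] is normal, of squared norm [|a^2 + b^2|]. *)
Lemma comm_sa_norm a b : star a = a -> star b = b -> GRing.comm a b ->
  cnorm a ^+ 2 <= cnorm (a * a + b * b).
Proof.
move=> sa sb ab; pose u := a + 'i%C *: b.
have su : star u = a - 'i%C *: b by rewrite starD starZ conjCi sa sb scaleNr.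
have -> : a * a + b * b = star u * u.
  rewrite su mulrBl !mulrDr -!scalerAl -!scalerAr scalerA mulCii scaleN1r.
  by rewrite opprB ab addrACA subrr addr0.
rewrite cstar_identity lerXn2r ?nnegrE ?cnorm_ge0 //.
have : cnorm (u + star u) <= cnorm u + cnorm u by rewrite -[X in _ <= _ + X]cnorm_star cnormD.
have -> : u + star u = (2 : R)%:C *: a.
  by rewrite su addrCA addrK -mulr2n [in RHS]rmorph_nat scaler_nat.
rewrite cnormZr //; lra.
Qed.

(** With [|a| <= 1] after scaling and [(1 - b)^2 = 1 - a^2], the elements [1 - b] and [a] commute,
    so [|1 - a^2| = |1 - b|^2 <= |(1 - b)^2 + a^2| = 1]. *)
Lemma cpos_sqr a : star a = a -> cpos (a * a).
Proof.
move=> sa; have n0 := cnorm_ge0 a.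
pose d := cnorm a + 1; have n1 : 0 < d by rewrite ltr_wpDl.
pose a1 := (d^-1)%:C *: a.
have sa1 : star a1 = a1 by rewrite starZr sa.
have na1 : cnorm a1 <= 1.
  by rewrite cnormZr ?invr_ge0 ?(ltW n1) // ler_pdivrMl // mulr1 lerDl.
have ns : cnorm (a1 * a1) <= 1 by rewrite cnorm_sa // expr_le1 // cnorm_ge0.
have ss : star (a1 * a1) = a1 * a1 by rewrite starM sa1.
have [B [Bs BB _ /(_ a1) Bc]] := sqrt_one_sub_sa ss ns.
have -> : a * a = (d * d)%:C *: (a1 * a1).
  rewrite -scalerAl -scalerAr !scalerA -!rmorphM /=.
  by rewrite mulfK ?gt_eqF // divff ?gt_eqF // scale1r.
apply: cposZ; first by rewrite mulr_ge0 // ltW.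
split=> //; have sb : star (1 - B) = 1 - B by rewrite starB star1 Bs.
have H := @comm_sa_norm (1 - B) a1 sb sa1; move: H; rewrite BB subrK cnorm1.
exists 1; rewrite rmorph1 scale1r -BB cnorm_sa //.
apply: H; apply/commr_sym/commrB; [exact: commr1 | apply/Bc/commrM => //].
Qed.

(** If [h = b^2] and [-h = c^2] with [b] and [c] commuting, then [|b|^2 <= |b^2 + c^2| = 0]. *)
Lemma cpos_anti h : cpos h -> cpos (- h) -> h = 0.
Proof.
move=> /cpos_sqrt[b [sb bb _ _]] /cpos_sqrt[c [sc cc _ hc]].
have bc : GRing.comm b c by apply: hc; rewrite -bb; apply: commrN; apply: commrM.
have := comm_sa_norm sb sc bc; rewrite bb cc subrr cnorm0 => n0.
have /cnorm0_eq0 b0 : cnorm b = 0 by apply/eqP; rewrite -sqrf_eq0 eq_le n0 sqr_ge0.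
by rewrite -bb b0 mulr0.
Qed.

(** The same comparison for roots [b] of [h] and [c] of [1 - h], where [b^2 + c^2 = 1]. *)
Lemma cpos_norm_le1 h : cpos h -> cpos (1 - h) -> cnorm h <= 1.
Proof.
move=> /cpos_sqrt[b [sb bb _ _]] /cpos_sqrt[c [sc cc _ hc]].
have bc : GRing.comm b c.
  by apply: hc; rewrite -bb; apply: commrB; [apply: commr1 | apply: commrM].
have := comm_sa_norm sb sc bc; rewrite bb cc addrC subrK cnorm1.
by rewrite -cnorm_sa // bb.
Qed.

(** If [r = 1 + d] with [d > 0], the square of Bernoulli's inequality at [2^N] makes [r^(2^(N+1))]
    grow quadratically in [2^N], beyond any linear bound. *)
Lemma pow2_le_linear r t : (forall m, r ^+ (2 ^ m) <= 1 + (2 ^ m)%:R * t) -> r <= 1.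
Proof.
move=> h; rewrite leNgt; apply/negP => r1; pose d := r - 1.
have d0 : 0 < d by rewrite subr_gt0.
have bern k : 1 + k%:R * d <= r ^+ k.
  elim: k => [|k IH]; first by rewrite mul0r addr0.
  have kd : 0 <= k%:R * d by rewrite mulr_ge0 // ltW.
  rewrite exprS -natr1; have -> : r = 1 + d by rewrite addrC subrK.
  move: IH; have -> : r = 1 + d by rewrite addrC subrK.
  nra.
have t0 : 0 <= t by have := h 0%N; rewrite expr1 mul1r; move: r1; lra.
have [N hN] : exists N : nat, (1 + 2 * t) / d ^+ 2 < N%:R.
  exists (Num.bound ((1 + 2 * t) / d ^+ 2)).
  by apply: archi_boundP; rewrite divr_ge0 ?sqr_ge0 //; lra.
have := h N.+1; rewrite expnSr exprM expr2 natrM; set k := (2 ^ N)%N.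
have kN : N%:R <= k%:R :> R by rewrite ler_nat ltnW // ltn_expl.
have k1 : 1 <= k%:R :> R by rewrite (ler_nat _ 1) expn_gt0.
have := bern k; move: hN; rewrite ltr_pdivrMr ?exprn_gt0 // => hN b1 b2.
have : (k%:R * d) ^+ 2 <= 1 + k%:R * 2 * t.
  apply: le_trans b2; rewrite -expr2 lerXn2r ?nnegrE ?mulr_ge0 ?exprn_ge0 // ?ltW //.
    by apply: lt_trans r1.
  by move: b1; lra.
have : 1 + 2 * t < k%:R * d ^+ 2 by apply: lt_le_trans hN _; rewrite ler_wpM2r ?sqr_ge0.
nra.
Qed.

(* [(t - x^* x) ^ n] and [(t - x x^* ) ^ n] differ by terms of linear growth in [n], and the norm
   of a self-adjoint element is governed by its [2 ^ m]-th powers. *)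
Lemma cpos_mul_comm x : cpos (x * star x) -> cpos (star x * x).
Proof.
case=> _ [t0 h0]; split; first by rewrite starM starK.
(* Adding 1 makes [t] positive, so that it can be divided by. *)
pose t := t0 + 1; have t0p : 0 <= t0 := le_trans (cnorm_ge0 _) h0.
have tp : 0 < t by rewrite ltr_wpDl.
have ht : cnorm (t%:C%:A - x * star x) <= t.
  rewrite /t rmorphD scalerDl addrAC (le_trans (cnormD _ _)) // lerD //.
  by rewrite rmorph1 scale1r cnorm1.
exists t; set X := t%:C%:A - star x * x; set Y := t%:C%:A - x * star x in ht.
have sX : star X = X by rewrite starB star_alg_real starM starK.
have xX : x * X = Y * x.
  by rewrite mulrBr mulrBl mulrA -scalerAr -scalerAl mulr1 mul1r.
have xXn n : x * X ^+ n = Y ^+ n * x.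
  elim: n => [|n IH]; first by rewrite mulr1 mul1r.
  by rewrite exprS mulrA xX -mulrA IH mulrA -exprS.
have Yn n : cnorm (Y ^+ n) <= t ^+ n.
  elim: n => [|n IH]; first by rewrite !expr0 cnorm1.
  by rewrite !exprS (le_trans (cnormM _ _)) // ler_pM ?cnorm_ge0.
pose N := cnorm x ^+ 2.
have Xn n : cnorm (X ^+ n) * t <= t ^+ n * (t + n%:R * N).
  elim: n => [|n IH]; first by rewrite !expr0 cnorm1 mul0r addr0.
  have -> : X ^+ n.+1 = t%:C *: X ^+ n - star x * (Y ^+ n * x).
    by rewrite exprS {1}/X mulrBl -scalerAl mul1r -mulrA xXn.
  have e1 : cnorm (t%:C *: X ^+ n) = t * cnorm (X ^+ n) by rewrite cnormZr ?ltW.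
  have e2 : cnorm (star x * (Y ^+ n * x)) <= t ^+ n * N.
    rewrite (le_trans (cnormM _ _)) // cnorm_star /N expr2 mulrCA ler_wpM2l ?cnorm_ge0 //.
    by rewrite (le_trans (cnormM _ _)) // ler_wpM2r ?cnorm_ge0.
  have := cnormD (t%:C *: X ^+ n) (- (star x * (Y ^+ n * x))); rewrite cnormN e1 => e3.
  rewrite exprS -natr1; move: IH e2 e3.
  move: (cnorm _) (cnorm (X ^+ n)) (cnorm _) (t ^+ n) => u v p q IH e2 e3; nra.
suff : cnorm X / t <= 1 by rewrite ler_pdivrMr // mul1r.
apply: (@pow2_le_linear _ (N / t)) => m; have := Xn (2 ^ m)%N.
rewrite cnorm_sa_exp2 // expr_div_n ler_pdivrMr ?exprn_gt0 //.
rewrite -ler_pdivlMr // => /le_trans; apply.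
by rewrite -mulrA mulrC mulrDl divff ?gt_eqF // mulrA.
Qed.

Lemma sqr_re_im x (s := star x) : (x + s) * (x + s) + ('i%C *: (x - s)) * ('i%C *: (x - s))
  = (2 : R)%:C *: (x * s + s * x).
Proof.
move: s => s; rewrite -scalerAl -scalerAr scalerA mulCii scaleN1r.
have -> : (x + s) * (x + s) = (x * x + s * s) + (x * s + s * x).
  by rewrite mulrDl !mulrDr [s * x + _]addrC addrACA.
have -> : (x - s) * (x - s) = (x * x + s * s) - (x * s + s * x).
  by rewrite mulrBl !mulrBr opprB addrACA [- (x * s) - _]addrC -opprD [s * x + _]addrC.
by rewrite opprB addrC addrA subrK rmorph_nat scaler_nat mulr2n.
Qed.

(* With [a = y^* y], [p = |a|] and [e = p - a], the element [x = y e] satisfies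
   [x^* x = - e p e <= 0], whence [x = 0], [e ^ 3 = 0] and [a = p]. *)
Lemma cpos_star_mul y : cpos (star y * y).
Proof.
pose a := star y * y.
have sa : star a = a by rewrite starM starK.
have [p [sp pp posp pc]] := cpos_sqrt (cpos_sqr sa).
have ap : GRing.comm a p by apply: pc; apply: commrM.
have [d [sd dd _ dc]] := cpos_sqrt posp.
pose e := p - a.
have se : star e = e by rewrite starB sp sa.
have ea : e * a = - (e * p).
  apply/eqP; rewrite -subr_eq0 opprK -mulrDr /e mulrBl !mulrDr pp -ap.
  by rewrite (addrC (a * p)) subrr.
have ce : GRing.comm e p by apply: commr_sym; apply: commrB => //; apply: commr_sym.
have de : GRing.comm e d by apply: dc.
have ae : GRing.comm e a by apply: commr_sym; apply: commrB => //.
pose x := y * e.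
have xx : star x * x = e * (e * a).
  by rewrite /x starM se mulrA -(mulrA e) -mulrA -ae.
have posN : cpos (- (star x * x)).
  have -> : - (star x * x) = (e * d) * (e * d).
    by rewrite xx ea mulrN opprK -dd -[RHS]mulrA (mulrA d) -de -mulrA.
  by apply: cpos_sqr; rewrite starM se sd.
(* [x x^*] is half the sum of the squares of the self-adjoint elements [x1] and [x2], plus the
   positive element [- x^* x]. *)
have posP : cpos (x * star x).
  pose x1 := x + star x; pose x2 := 'i%C *: (x - star x).
  have s1 : star x1 = x1 by rewrite starD starK addrC.
  have s2 : star x2 = x2.
    by rewrite starZ conjCi starB starK scaleNr -scalerN opprB.
  have -> : x * star x = (2^-1 : R)%:C *: (x1 * x1 + x2 * x2) + - (star x * x).
    rewrite sqr_re_im.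
    by rewrite scalerA -rmorphM mulVf ?pnatr_eq0 // scale1r addrK.
  apply: cposD => //; apply: cposZ; first by rewrite invr_ge0.
  by apply: cposD; apply: cpos_sqr.
have x0 : star x * x = 0 by apply: cpos_anti => //; apply: cpos_mul_comm.
have eea : e * (e * a) = 0 by rewrite -xx.
have eep : e * (e * p) = 0 by apply: oppr_inj; rewrite -mulrN -ea eea oppr0.
have eee : e * (e * e) = 0 by rewrite {3}/e !mulrBr eea eep subrr.
(* [e^3 = 0] gives [e^4 = 0], and a self-adjoint element of square 0 vanishes; this applies to [e^2]
   and then to [e]. *)
have e0 : e = 0.
  apply: sa_sqr_eq0 => //; apply: sa_sqr_eq0; first by rewrite starM se.
  by rewrite -mulrA eee mulr0.
by have -> : star y * y = p by apply/esym/eqP; rewrite -subr_eq0; apply/eqP.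
Qed.

Lemma cpos_conj h z : cpos h -> cpos (star z * h * z).
Proof.
case/cpos_sqrt => b [sb <- _ _].
have -> : star z * (b * b) * z = star (b * z) * (b * z) by rewrite starM sb !mulrA.
exact: cpos_star_mul.
Qed.

(** The negative of one summand is the sum of the others, so both it and its negative are
    positive. *)
Lemma sum_star_mul_eq0 (I : finType) (f : I -> A) :
  \sum_i star (f i) * f i = 0 -> forall i, f i = 0.
Proof.
move=> s0 i; apply: star_mul_eq0; apply: cpos_anti; first exact: cpos_star_mul.
have -> : - (star (f i) * f i) = \sum_(k | k != i) star (f k) * f k.
  by move: s0; rewrite (bigD1 i) //= => /eqP; rewrite addrC addr_eq0 => /eqP.
by apply: cpos_sum => k _; apply: cpos_star_mul.
Qed.

End Positivity.

(** * Positive matrices over a C*-algebra *)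

Section MatrixPositivity.
Variables (R : realType) (A : cstarAlgType R).
Implicit Types (c : R[i]) (r t : R).

Lemma mxstarE n (M : 'M[A]_n) i j : mxstar M i j = star (M j i).
Proof. by rewrite !mxE. Qed.

Lemma mxstarK n : involutive (@mxstar R A n).
Proof. by move=> M; apply/matrixP => i j; rewrite !mxstarE starK. Qed.

Lemma mxstarD n (M N : 'M[A]_n) : mxstar (M + N) = mxstar M + mxstar N.
Proof. by apply/matrixP => i j; rewrite !mxE starD. Qed.

Lemma mxstarB n (M N : 'M[A]_n) : mxstar (M - N) = mxstar M - mxstar N.
Proof. by apply/matrixP => i j; rewrite !mxE starB. Qed.

Lemma mxstar1 n : mxstar (1 : 'M[A]_n) = 1.
Proof.
by apply/matrixP => i j; rewrite !mxE eq_sym; case: eqP => _; rewrite ?star1 ?star0.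
Qed.

Lemma mxstarM n (M N : 'M[A]_n) : mxstar (M * N) = mxstar N * mxstar M.
Proof.
apply/matrixP => i j; rewrite !mxE star_sum; apply: eq_bigr => k _.
by rewrite starM !mxE.
Qed.

Lemma mxstarZr n r (M : 'M[A]_n) : mxstar ((r%:C%:A : A) *: M) = (r%:C%:A : A) *: mxstar M.
Proof. by apply/matrixP => i j; rewrite !mxE !mulr_algl starZr. Qed.

Definition qform n (M : 'M[A]_n) (x : 'I_n -> A) : A :=
  \sum_i \sum_j star (x i) * (M i j * x j).

Lemma qformD n (M N : 'M[A]_n) x : qform (M + N) x = qform M x + qform N x.
Proof.
rewrite /qform -big_split; apply: eq_bigr => i _ /=.
by rewrite -big_split; apply: eq_bigr => j _ /=; rewrite mxE mulrDl mulrDr.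
Qed.

Lemma qformZr n r (M : 'M[A]_n) x : qform ((r%:C%:A : A) *: M) x = r%:C *: qform M x.
Proof.
rewrite /qform scaler_sumr; apply: eq_bigr => i _ /=.
rewrite scaler_sumr; apply: eq_bigr => j _ /=.
by rewrite mxE mulr_algl -scalerAl -scalerAr.
Qed.

Lemma qformN n (M : 'M[A]_n) x : qform (- M) x = - qform M x.
Proof.
rewrite /qform -sumrN; apply: eq_bigr => i _.
by rewrite -sumrN; apply: eq_bigr => j _; rewrite mxE mulNr mulrN.
Qed.

Lemma qform1 n x : qform (1 : 'M[A]_n) x = \sum_i star (x i) * x i.
Proof.
apply: eq_bigr => i _; rewrite (bigD1 i) //= big1 => [|j ji]; rewrite !mxE.
  by rewrite eqxx mul1r addr0.
by rewrite eq_sym (negbTE ji) mul0r mulr0.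
Qed.

Lemma qform_conj n (M Y : 'M[A]_n) x :
  qform (mxstar Y * M * Y) x = qform M (fun i => \sum_j Y i j * x j).
Proof.
rewrite /qform.
have E i j : (mxstar Y * M * Y) i j = \sum_k \sum_l star (Y k i) * (M k l * Y l j).
  rewrite [LHS]mxE exchange_big; apply: eq_bigr => l _ /=.
  rewrite [X in X * _]mxE mulr_suml; apply: eq_bigr => k _.
  by rewrite mxstarE mulrA.
transitivity (\sum_i \sum_j \sum_k \sum_l star (x i) * (star (Y k i) * (M k l * Y l j) * x j)).
  apply: eq_bigr => i _; apply: eq_bigr => j _; rewrite E mulr_suml mulr_sumr.
  by apply: eq_bigr => k _; rewrite mulr_suml mulr_sumr.
under eq_bigr do rewrite exchange_big; rewrite exchange_big; apply: eq_bigr => k _ /=.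
under eq_bigr do rewrite exchange_big; rewrite exchange_big; apply: eq_bigr => l _ /=.
rewrite star_sum mulr_suml; apply: eq_bigr => i _; rewrite mulr_sumr mulr_sumr.
by apply: eq_bigr => j _; rewrite starM !mulrA.
Qed.

(* Matrices carry no C*-norm here; positivity is that of the quadratic form. *)
Definition mxpos n (M : 'M[A]_n) : Prop := mxstar M = M /\ forall x, cpos (qform M x).

Lemma mxpos1 n : mxpos (1 : 'M[A]_n).
Proof.
split=> [|x]; first exact: mxstar1.
by rewrite qform1; apply: cpos_sum => i _; apply: cpos_star_mul.
Qed.

Lemma mxposD n (M N : 'M[A]_n) : mxpos M -> mxpos N -> mxpos (M + N).
Proof.
move=> [sM pM] [sN pN]; split=> [|x]; first by rewrite mxstarD sM sN.
by rewrite qformD; apply: cposD.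
Qed.

Lemma mxpos0 n : mxpos (0 : 'M[A]_n).
Proof.
split=> [|x]; first by apply/matrixP => i j; rewrite !mxE star0.
have -> : qform 0 x = 0; last exact: cpos0.
by rewrite /qform big1 // => i _; rewrite big1 // => j _; rewrite mxE mul0r mulr0.
Qed.

Lemma mxposZ n r (M : 'M[A]_n) : 0 <= r -> mxpos M -> mxpos ((r%:C%:A : A) *: M).
Proof.
move=> r0 [sM pM]; split=> [|x]; first by rewrite mxstarZr sM.
by rewrite qformZr; apply: cposZ.
Qed.

Lemma mxpos_sum n (I : Type) (s : seq I) (P : pred I) (f : I -> 'M[A]_n) :
  (forall i, P i -> mxpos (f i)) -> mxpos (\sum_(i <- s | P i) f i).
Proof.
by move=> h; apply: big_ind => //; [apply: mxpos0 | apply: mxposD].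
Qed.

Lemma mxpos_conj n (M Y : 'M[A]_n) : mxpos M -> mxpos (mxstar Y * M * Y).
Proof.
move=> [sM pM]; split=> [|x]; first by rewrite !mxstarM mxstarK sM mulrA.
by rewrite qform_conj.
Qed.

Lemma mxpos_conj_sa n (M Y : 'M[A]_n) : mxstar Y = Y -> mxpos M -> mxpos (Y * M * Y).
Proof. by move=> sY /(mxpos_conj Y); rewrite sY. Qed.

Lemma mxpositive_mxpos n (M : 'M[A]_n) : mxpositive M -> mxpos M.
Proof. by case=> Y ->; have := mxpos_conj Y (mxpos1 n); rewrite mulr1. Qed.

(** Pairs the entry [(i, j)] with its mirror image, which gives each summand the self-adjoint shape
    of [cpos_young]. *)
Lemma qform_sym n (M : 'M[A]_n) x : mxstar M = M ->
  qform M x + qform M x =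
  \sum_i \sum_j (star (x i) * (M i j * x j) + star (x j) * (star (M i j) * x i)).
Proof.
move=> sM; rewrite {2}/qform exchange_big -big_split; apply: eq_bigr => i _ /=.
rewrite -big_split; apply: eq_bigr => j _ /=.
by rewrite -(mxstarE M) sM.
Qed.

(** Young's inequality by completing the square: the element is [(a - m b)^* (a - m b) + b^* (|m|^2
    - m^* m) b]. *)
Lemma cpos_young (a b m : A) :
  cpos (star a * a + (cnorm m ^+ 2)%:C *: (star b * b)
        - (star a * (m * b) + star b * (star m * a))).
Proof.
have -> : star a * a + (cnorm m ^+ 2)%:C *: (star b * b)
        - (star a * (m * b) + star b * (star m * a)) =
   star (a - m * b) * (a - m * b) +
   star b * ((cnorm m ^+ 2)%:C%:A - star m * m) * b.
  rewrite starB starM mulrBl !mulrBr mulrBl opprB -scalerAr -scalerAl mulr1 !mulrA.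
  by rewrite [RHS]addrAC -[RHS]addrA [X in _ = _ + X]addrA subrK addrACA -opprD.
apply: cposD; first exact: cpos_star_mul.
apply: cpos_conj; rewrite -cstar_identity; apply: cpos_norm.
by rewrite starM starK.
Qed.

(** Summing [cpos_young] over all pairs of entries bounds twice the form of [M] by [T N], with [N]
    the form of the identity and [T] the double sum in [t]. The added 1 makes [t] positive even in
    size 0. *)
Lemma mxpos_bound n (M : 'M[A]_n) : mxstar M = M ->
  exists2 t : R, 0 < t & mxpos ((t%:C%:A : A) *: (1 : 'M[A]_n) - M).
Proof.
move=> sM; pose k i j := cnorm (M i j) ^+ 2.
have k0 i j : 0 <= k i j by apply: sqr_ge0.
pose t := 1 + \sum_i \sum_j (1 + k i j); exists t.
  rewrite ltr_wpDr //; apply: sumr_ge0 => i _; apply: sumr_ge0 => j _.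
  by rewrite addr_ge0.
split=> [|x]; first by rewrite mxstarB mxstarZr mxstar1 sM.
rewrite qformD qformZr qformN; pose N := qform 1 x; rewrite -/N.
have pN : cpos N by case: (mxpos1 n) => _; apply.
have Ni i : cpos (N - star (x i) * x i).
  rewrite /N qform1 (bigD1 i) //= addrAC subrr add0r.
  by apply: cpos_sum => j _; apply: cpos_star_mul.
have key i j : cpos ((1 + k i j)%:C *: N
    - (star (x i) * (M i j * x j) + star (x j) * (star (M i j) * x i))).
  have := cposD (cpos_young (x i) (x j) (M i j)) (cposD (Ni i) (cposZ (k0 i j) (Ni j))).
  rewrite rmorphD /= scalerDl scale1r scalerBr [X in _ + X]addrACA -opprD -/(k i j).
  by rewrite [X in cpos X -> _]addrC [X in cpos X -> _]addrA subrK.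
have : cpos ((\sum_i \sum_j (1 + k i j))%:C *: N - (qform M x + qform M x)).
  rewrite qform_sym // rmorph_sum /= scaler_suml -sumrB; apply: cpos_sum => i _.
  by rewrite rmorph_sum /= scaler_suml -sumrB; apply: cpos_sum => j _.
set T := \sum_i _ => pT; have T0 : 0 <= T.
  by apply: sumr_ge0 => i _; apply: sumr_ge0 => j _; rewrite addr_ge0.
have pN2 : cpos ((T + 2)%:C *: N) by apply: cposZ => //; rewrite addr_ge0.
have -> : t%:C *: N - qform M x =
  (2^-1 : R)%:C *: ((T + 2)%:C *: N + (T%:C *: N - (qform M x + qform M x))).
  rewrite addrA -scalerDl -rmorphD scalerBr scalerA -rmorphM /=; congr (_%:C *: _ - _).
    by rewrite /t -/T; field.
  by rewrite half_double.
by apply: cposZ; [rewrite invr_ge0 | apply: cposD].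
Qed.

(** [S - S^2] is a sum of two conjugates of positive matrices. This avoids matrix square roots,
    whose construction rests on this lemma. *)
Lemma mxpos_sub_sqr n (S : 'M[A]_n) : mxpos S -> mxpos (1 - S) -> mxpos (S - S * S).
Proof.
move=> pS pS1; have [sS _] := pS; have [sS1 _] := pS1.
have -> : S - S * S = S * (1 - S) * S + (1 - S) * S * (1 - S).
  rewrite mulrBl mul1r !mulrBr !mulr1 [(S - S * S) * S]mulrBl.
  by rewrite -!mulrA [RHS]addrC subrK.
by apply: mxposD; apply: mxpos_conj_sa.
Qed.

(** Induction in steps of two: [S^(k+2) = S S^k S] and [1 - S^(k+2) = (1 - S) + (S - S^2) + S (1 -
    S^k) S]. *)
Lemma mxpos_powers n (S : 'M[A]_n) : mxpos S -> mxpos (1 - S) ->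
  forall k, mxpos (S ^+ k) /\ mxpos (1 - S ^+ k).
Proof.
move=> pS pS1; have [sS _] := pS.
have H k : (mxpos (S ^+ k) /\ mxpos (1 - S ^+ k)) /\
           (mxpos (S ^+ k.+1) /\ mxpos (1 - S ^+ k.+1)).
  elim: k => [|k [[pk pk1] IH]].
    by rewrite expr0 expr1 subrr; split=> //; split; [apply: mxpos1 | apply: mxpos0].
  have E : S ^+ k.+2 = S * S ^+ k * S by rewrite -exprS -exprSr.
  split=> //; rewrite E; split; first exact: mxpos_conj_sa.
  have -> : 1 - S * S ^+ k * S = (1 - S) + ((S - S * S) + S * (1 - S ^+ k) * S).
    by rewrite mulrBr mulr1 mulrBl !addrA !subrK.
  by apply: mxposD => //; apply: mxposD; [apply: mxpos_sub_sqr | apply: mxpos_conj_sa].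
by move=> k; case: (H k).
Qed.

(** [1 - S^2 = (1 - S) + (S - S^2)] is positive, and its diagonal entry at [j] is 1 minus the sum
    over [k] of [star (S k j) * S k j]; hence each of these terms is at most 1. *)
Lemma mxpos_entry_le1 n (S : 'M[A]_n) i j : mxpos S -> mxpos (1 - S) -> cnorm (S i j) <= 1.
Proof.
move=> pS pS1; have [sS _] := pS.
have [_ /(_ (fun k => (k == j)%:R))] := mxposD pS1 (mxpos_sub_sqr pS pS1).
rewrite addrA subrK qformD qform1 qformN.
have sb (b : bool) : star (b%:R : A) = b%:R by case: b; rewrite ?star0 ?star1.
rewrite (bigD1 j) //= eqxx star1 mulr1 big1 => [|k kj]; last by rewrite (negbTE kj) mulr0.
rewrite addr0 /qform (bigD1 j) //= [X in _ - (_ + X)]big1 => [|k kj]; last first.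
  by rewrite big1 // => l _; rewrite (negbTE kj) star0 mul0r.
rewrite addr0 (bigD1 j) //= [X in _ - (_ + X)]big1 => [|k kj]; last first.
  by rewrite (negbTE kj) !mulr0.
rewrite eqxx star1 mul1r mulr1 addr0 mxE (bigD1 i) //= -{1}sS mxstarE opprD addrA => H.
have : cnorm (star (S i j) * S i j) <= 1.
  apply: cpos_norm_le1; first exact: cpos_star_mul.
  rewrite -[X in cpos X](subrK (\sum_(k < n | k != i) S j k * S k j)).
  apply: cposD => //; apply: cpos_sum => k _; rewrite -{1}sS mxstarE.
  exact: cpos_star_mul.
by rewrite cstar_identity expr_le1 // cnorm_ge0.
Qed.

(** Keeping the entries in [C] lets a homomorphism defined only on [C] act on the factorization.
    With [t] an upper bound of [M], the matrix [S = 1 - M / t] lies between 0 and 1, and the root is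
    [sqrt t (1 - B)]. *)
Lemma mxpos_sqrt n (C : set A) (M : 'M[A]_n) :
  cstar_subalgebra C -> C 1 -> (forall i j, C (M i j)) -> mxpos M ->
  exists Z : 'M[A]_n, (forall i j, C (Z i j)) /\ M = mxstar Z *m Z.
Proof.
move=> [Ccl [C0 Clin] Cmul Cstar] C1 CM pM; have [sM _] := pM.
have CD x y : C x -> C y -> C (x + y) by move=> hx hy; have := Clin 1 x y hx hy; rewrite scale1r.
have CZ c x : C x -> C (c *: x) by move=> hx; have := Clin c x 0 hx C0; rewrite addr0.
have CB x y : C x -> C y -> C (x - y).
  by move=> hx hy; apply: CD => //; rewrite -scaleN1r; apply: CZ.
have Csum m (f : 'I_m -> A) : (forall i, C (f i)) -> C (\sum_i f i).
  by move=> h; apply: big_ind.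
have Cid i j : C ((1 : 'M[A]_n) i j) by rewrite mxE; case: eqP.
have [t t0 pt] := mxpos_bound sM.
pose S := 1 - (((t^-1)%:C%:A : A) *: M).
have ti : 0 <= t^-1 by rewrite invr_ge0 ltW.
have scK (N : 'M[A]_n) : ((t^-1)%:C%:A : A) *: ((t%:C%:A : A) *: N) = N.
  by rewrite alg_scalemxA -rmorphM mulVf ?gt_eqF // !scale1r.
have pS1 : mxpos (1 - S) by rewrite subKr; apply: mxposZ.
have pS : mxpos S.
  have := mxposZ ti pt; rewrite scalerBr scK.
  by [].
have pw := mxpos_powers pS pS1.
have bnd k i j : cnorm ((S ^+ k) i j) <= 1 by case: (pw k) => *; apply: mxpos_entry_le1.
have [B [BB BQ]] := sqrt_one_sub_mx bnd.
have sS : mxstar S = S by case: pS.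
have sB : mxstar B = B.
  apply: (BQ (fun N => mxstar N = N)); first by case: (mxpos0 n).
    by move=> N sN; rewrite mxstarZr mxstarD mxstarM sS sN.
  move=> u N su uN; apply/matrixP => i j; rewrite mxstarE.
  apply: (tends_unique (tends_star (uN j i))).
  by under eq_fun do rewrite -mxstarE su; apply: uN.
have CB' i j : C (B i j).
  move: i j; apply: (BQ (fun N => forall i j, C (N i j))) => [i j|N CN i j|u N Cu uN i j].
  - by rewrite mxE.
  - rewrite !mxE mulr_algl; apply/CZ/CD; last by apply: Csum => k; apply: Cmul.
    by rewrite mulr_algl; apply: CB; [have := Cid i j; rewrite mxE | apply: CZ].
  - by apply: (Ccl (fun m => u m i j)) => //; apply: uN.
exists (((Num.sqrt t)%:C%:A : A) *: (1 - B)); split.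
  move=> i j; rewrite !mxE mulr_algl; apply/CZ/CB => //.
  by have := Cid i j; rewrite mxE.
rewrite mxstarZr mxstarB mxstar1 sB -[RHS]/(_ * _) alg_scalemxAr.
have -> : ((Num.sqrt t)%:C%:A : A) *: (1 - B) * (1 - B) =
  ((Num.sqrt t)%:C%:A : A) *: ((1 - B) * (1 - B)) by rewrite /GRing.mul /= scalemxAl.
rewrite BB subKr !alg_scalemxA -!rmorphM /= -expr2.
by rewrite sqr_sqrtr ?ltW // divff ?gt_eqF // !scale1r.
Qed.

Lemma mxpos_mxpositive n (M : 'M[A]_n) : mxpos M -> mxpositive M.
Proof.
have sT : cstar_subalgebra [set: A] by split.
by case/(mxpos_sqrt sT I (fun _ _ => I)) => Z [_ ->]; exists Z.
Qed.

End MatrixPositivity.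

(** * Completely positive maps and multiplicative domains *)

Section CompletelyPositive.
Variables (R : realType) (A : cstarAlgType R).
Implicit Types (Phi : A -> A) (C : set A).

(** Stated with [mxpos], which passes to sums at once and is equivalent to [mxpositive]. *)
Definition cp_map Phi : Prop := forall n (M : 'M[A]_n), mxpos M -> mxpos (map_mx Phi M).

(** On matrices this is conjugation by the diagonal matrix [b%:M]. *)
Lemma cp_conj (b : A) : cp_map (fun x => star b * x * b).
Proof.
move=> n M /(mxpos_conj (b%:M)); congr mxpos; apply/matrixP => i j.
rewrite !mxE (bigD1 j) //= big1 => [|k kj]; last by rewrite [_%:M _ _]mxE (negbTE kj) mulr0.
rewrite addr0 [_%:M _ _]mxE eqxx mulr1n; congr (_ * _); rewrite mxE (bigD1 i) //= big1 => [|k ki].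
  by rewrite addr0 mxstarE mxE eqxx.
by rewrite mxstarE mxE (negbTE ki) star0 mul0r.
Qed.

Lemma cp_add Phi1 Phi2 : cp_map Phi1 -> cp_map Phi2 -> cp_map (fun x => Phi1 x + Phi2 x).
Proof.
move=> h1 h2 n M pM; have := mxposD (h1 _ _ pM) (h2 _ _ pM).
by congr mxpos; apply/matrixP => i j; rewrite !mxE.
Qed.

Lemma cp_scale (r : R) Phi : 0 <= r -> cp_map Phi -> cp_map (fun x => r%:C *: Phi x).
Proof.
move=> r0 h n M pM; have := mxposZ r0 (h _ _ pM).
by congr mxpos; apply/matrixP => i j; rewrite !mxE mulr_algl.
Qed.

Lemma cp_sum (I : Type) (s : seq I) (f : I -> A -> A) :
  (forall i, cp_map (f i)) -> cp_map (fun x => \sum_(i <- s) f i x).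
Proof.
move=> h n M pM; have := @mxpos_sum _ _ n _ s xpredT (fun i => map_mx (f i) M).
move=> /(_ (fun i _ => h i _ _ pM)); congr mxpos.
by apply/matrixP => i j; rewrite summxE mxE; apply: eq_bigr => k _; rewrite mxE.
Qed.

Lemma cp_comp Phi1 Phi2 : cp_map Phi1 -> cp_map Phi2 -> cp_map (Phi1 \o Phi2).
Proof. by move=> h1 h2 n M pM; rewrite map_mx_comp; apply/h1/h2. Qed.

Lemma cp_mxpositive Phi n (M : 'M[A]_n) :
  cp_map Phi -> mxpositive M -> mxpositive (map_mx Phi M).
Proof. by move=> h /mxpositive_mxpos/h/mxpos_mxpositive. Qed.

Lemma linear_on_scale (I : cstarAlgType R) (C : set A) (f : A -> I) (c : R[i]) x :
  C 0 -> (forall (c : R[i]) x y, C x -> C y -> f (c *: x + y) = c *: f x + f y) ->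
  C x -> f (c *: x) = c *: f x.
Proof.
move=> C0 flin Cx; have := flin c x 0 Cx C0; rewrite addr0 => ->.
have := flin (-1) 0 0 C0 C0; rewrite scaler0 addr0 scaleN1r addNr => ->.
by rewrite addr0.
Qed.

Lemma linear_on_sum (I : cstarAlgType R) (C : set A) (f : A -> I) (K : Type) (s : seq K)
    (P : pred K) (x : K -> A) :
  C 0 /\ (forall (c : R[i]) x y, C x -> C y -> C (c *: x + y)) ->
  (forall (c : R[i]) x y, C x -> C y -> f (c *: x + y) = c *: f x + f y) ->
  (forall k, P k -> C (x k)) -> f (\sum_(k <- s | P k) x k) = \sum_(k <- s | P k) f (x k).
Proof.
move=> [C0 Clin] flin Cx.
have f0 : f 0 = 0 by have := linear_on_scale 0 C0 flin C0; rewrite !scale0r.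
suff [] : C (\sum_(k <- s | P k) x k) /\
  f (\sum_(k <- s | P k) x k) = \sum_(k <- s | P k) f (x k) by [].
elim/big_rec2: _ => [|k z y Pk [Cy fy]]; first by [].
have := flin 1 (x k) y (Cx _ Pk) Cy; have := Clin 1 (x k) y (Cx _ Pk) Cy.
by rewrite !scale1r => ? ->; rewrite fy.
Qed.

(** The image of a positive matrix under [Phi] factors as [Z^* Z] with entries of [Z] in [C], where
    [j] is a homomorphism and preserves the factorization. *)
Lemma ucp_star_hom_comp (I : cstarAlgType R) (j : A -> I) C Phi :
  cstar_subalgebra C -> C 1 -> unital_star_hom_on C j ->
  cp_map Phi -> Phi 1 = 1 -> (forall x, C (Phi x)) ->
  (forall (c : R[i]) x y, Phi (c *: x + y) = c *: Phi x + Phi y) ->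
  ucp_on [set: A] [set: I] (j \o Phi).
Proof.
move=> sC C1 [j1 jlin jM jS] cpP P1 PC Plin; split=> //=.
- by rewrite P1.
- by move=> c x y _ _; rewrite Plin jlin.
move=> n M _ /mxpositive_mxpos/cpP pM.
have [Z [CZ eZ]] : exists Z : 'M[A]_n, (forall i k, C (Z i k)) /\ map_mx Phi M = mxstar Z *m Z.
  by apply: mxpos_sqrt => // i k; rewrite mxE.
have [_ Clin CM CS] := sC.
exists (map_mx j Z); rewrite map_mx_comp eZ; apply/matrixP => i k; rewrite !mxE.
rewrite (linear_on_sum _ Clin jlin) => [|l _]; last by apply: CM => //; rewrite mxstarE; apply: CS.
by apply: eq_bigr => l _; rewrite !mxstarE jM ?mxE ?jS //; apply: CS.
Qed.

(* The image of the Gram matrix of [1, u, x] has the form [Z^* Z]; its first two columns satisfy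
   [z_2 = z_1 v] because the difference has norm 0. *)
Lemma ucp_mult_domain (I : cstarAlgType R) (Psi : A -> I) (u : A) (v : I) :
  ucp_on [set: A] [set: I] Psi -> Psi u = v -> Psi (star u) = star v ->
  star u * u = 1 -> star v * v = 1 ->
  forall x, Psi (star u * x) = star v * Psi x /\ Psi (x * u) = Psi x * v.
Proof.
move=> [P1 _ _ Pcp] Pu Pus uu vv.
have key y : Psi (star u * y) = star v * Psi y /\ Psi (star y * u) = Psi (star y) * v.
  pose r (i : 'I_3) : A := if i == 0 then 1 else if i == 1 then u else y.
  pose M : 'M[A]_3 := \matrix_(i, k) (star (r i) * r k).
  have pM : mxpositive M.
    (* A matrix with first row [r] and zeros below. *)
    exists (\matrix_(i, k) if i == 0 then r k else 0).
    apply/matrixP => i k; rewrite !mxE (bigD1 0) //= big1 => [|l l0].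
      by rewrite mxstarE !mxE eqxx addr0.
    by rewrite !mxE (negbTE l0) mulr0.
  have [Z eZ] := Pcp _ M (fun _ _ => Logic.I) pM.
  have Ze i k : Psi (star (r i) * r k) = \sum_l star (Z l i) * Z l k.
    move/matrixP/(_ i k): eZ; rewrite !mxE => ->.
    by apply: eq_bigr => l _; rewrite mxstarE.
  have r0 : r 0 = 1 by []. have r1 : r 1 = u by [].
  have r2 : r 2 = y by [].
  have E00 := Ze 0 0; have E01 := Ze 0 1; have E10 := Ze 1 0; have E11 := Ze 1 1.
  have E02 := Ze 0 2; have E12 := Ze 1 2; have E20 := Ze 2 0; have E21 := Ze 2 1.
  rewrite ?r0 ?r1 ?r2 ?star1 ?mul1r ?mulr1 ?P1 ?Pu ?Pus ?uu in E00 E01 E10 E11 E02 E12 E20 E21.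
  rewrite P1 in E11.
  (* The four Gram sums are 1, [v], [star v] and 1, so the expansion is [(1 - 1) - (1 - 1)]. *)
  have z0 : \sum_l star (Z l 1 - Z l 0 * v) * (Z l 1 - Z l 0 * v) = 0.
    have -> : \sum_l star (Z l 1 - Z l 0 * v) * (Z l 1 - Z l 0 * v) =
      (\sum_l star (Z l 1) * Z l 1 - (\sum_l star (Z l 1) * Z l 0) * v)
      - (star v * (\sum_l star (Z l 0) * Z l 1)
         - star v * (\sum_l star (Z l 0) * Z l 0) * v).
      rewrite !mulr_sumr !mulr_suml -!sumrB; apply: eq_bigr => l _.
      by rewrite starB starM mulrBl !mulrBr !mulrA.
    by rewrite -E11 -E10 -E01 -E00 mulr1 vv !subrr.
  have zl l : Z l 1 = Z l 0 * v.
    by apply/eqP; rewrite -subr_eq0; apply/eqP; apply: (sum_star_mul_eq0 z0).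
  split.
    rewrite E12 E02 mulr_sumr; apply: eq_bigr => l _.
    by rewrite zl starM mulrA.
  by rewrite E21 E20 mulr_suml; apply: eq_bigr => l _; rewrite zl mulrA.
move=> x; split; first by case: (key x).
by have [_] := key (star x); rewrite starK.
Qed.

End CompletelyPositive.

(** * Averaging over a projective representation *)

Lemma card_group_neq0 (R : realType) (G : finGroupType) : #|G|%:R != 0 :> R.
Proof. by rewrite pnatr_eq0 -lt0n; apply/card_gt0P; exists 1%g. Qed.

Lemma mean_const (R : realType) (G : finGroupType) (A : cstarAlgType R) (x : A) :
  ((#|G|%:R^-1 : R))%:C *: (\sum_(g : G) x) = x.
Proof.
rewrite sumr_const; have -> : x *+ #|G| = ((#|G|%:R : R))%:C *: x by rewrite rmorph_nat scaler_nat.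
by rewrite scalerA -rmorphM mulVf ?card_group_neq0 // scale1r.
Qed.

Section Commutant.
Variables (R : realType) (G : finGroupType) (A : cstarAlgType R) (v : G -> A).
Hypothesis proj_v : projective_representation v.
Implicit Types (x y : A) (g h k : G).

Definition commutant : set A := [set x | forall g, v g * x = x * v g].

(** The conditional expectation of [A] onto the commutant. *)
Definition average x : A := ((#|G|%:R^-1 : R))%:C *: \sum_g Ad (v g) x.

Lemma proj_unitary g : unitary (v g). Proof. by case: proj_v. Qed.

Lemma AdZ (c : R[i]) (u x : A) : `|c| = 1 -> Ad (c *: u) x = Ad u x.
Proof.
move=> c1; rewrite /Ad starZ -scalerAl -scalerAl -scalerAr scalerA.
by rewrite mulrC conj_unit // scale1r.
Qed.

Lemma Ad_mul (u1 u2 x : A) : Ad u1 (Ad u2 x) = Ad (u1 * u2) x.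
Proof. by rewrite /Ad starM !mulrA. Qed.

(** The cocycle has modulus 1 and cancels under conjugation, so [Ad] turns [v] into a genuine
    action. *)
Lemma Ad_proj g h x : Ad (v g) (Ad (v h) x) = Ad (v (g * h)%g) x.
Proof.
case: proj_v => _ [sigma [s1 _] e].
by rewrite Ad_mul e AdZ.
Qed.

Lemma Ad_star (u x : A) : unitary u -> Ad (star u) (Ad u x) = x.
Proof. by move=> [u1 _]; rewrite Ad_mul u1 /Ad star1 mul1r mulr1. Qed.

(** [v 1] may differ from 1, but [Ad (v 1)] is idempotent and injective. *)
Lemma Ad_proj1 x : Ad (v 1%g) x = x.
Proof.
have inj y z : Ad (v 1%g) y = Ad (v 1%g) z -> y = z.
  by move=> e; rewrite -(Ad_star y (proj_unitary 1%g)) e Ad_star //; apply: proj_unitary.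
by apply: inj; rewrite Ad_proj mulg1.
Qed.

Lemma Ad_eq (u x y : A) : unitary u -> (Ad u x = y <-> u * x = y * u).
Proof.
move=> [u1 u2]; split=> [<-|e]; first by rewrite /Ad -!mulrA u1 mulr1.
by rewrite /Ad e -mulrA u2 mulr1.
Qed.

Lemma commutantP x : commutant x <-> forall g, Ad (v g) x = x.
Proof.
by split=> h g; apply/(Ad_eq _ _ (proj_unitary g))/h.
Qed.

Lemma commutant_star g x : commutant x -> star (v g) * x = x * star (v g).
Proof.
move=> h; have [u1 u2] := proj_unitary g.
by rewrite -[LHS]mulr1 -u2 !mulrA -(mulrA _ x) -h !mulrA u1 mul1r.
Qed.

Lemma commutant1 : commutant 1. Proof. by move=> g; rewrite mulr1 mul1r. Qed.

Lemma commutant_subalgebra : cstar_subalgebra commutant.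
Proof.
split.
- move=> u x Cu ux g; apply: (tends_unique (tendsM (tends_cst (v g)) ux)).
  by under eq_fun do rewrite Cu; apply: tendsM ux (tends_cst _).
- split=> [g|c x y hx hy g]; first by rewrite mulr0 mul0r.
  by rewrite mulrDr mulrDl -scalerAr -scalerAl hx hy.
- by move=> x y hx hy g; rewrite mulrA hx -mulrA hy mulrA.
- move=> x hx g; have /(congr1 (@star R A)) := commutant_star g hx.
  by rewrite !starM starK => ->.
Qed.

Lemma AdD (u : A) (c : R[i]) x y : Ad u (c *: x + y) = c *: Ad u x + Ad u y.
Proof. by rewrite /Ad mulrDr mulrDl -scalerAr -scalerAl. Qed.

Lemma average_linear (c : R[i]) x y : average (c *: x + y) = c *: average x + average y.
Proof.
rewrite /average scalerA mulrC -scalerA -scalerDr; congr (_ *: _).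
rewrite scaler_sumr -big_split; apply: eq_bigr => g _; exact: AdD.
Qed.

Lemma averageZ (c : R[i]) x : average (c *: x) = c *: average x.
Proof.
rewrite /average [RHS]scalerA mulrC -[RHS]scalerA; congr (_ *: _); rewrite scaler_sumr.
by apply: eq_bigr => g _; rewrite /Ad -scalerAr -scalerAl.
Qed.

Lemma averageD x y : average (x + y) = average x + average y.
Proof. by have := average_linear 1 x y; rewrite !scale1r. Qed.

Lemma averageN x : average (- x) = - average x.
Proof. by rewrite -scaleN1r averageZ scaleN1r. Qed.

Lemma average_commutant x : commutant (average x).
Proof.
apply/commutantP => h; rewrite /average /Ad -scalerAr -scalerAl; congr (_ *: _).
rewrite mulr_sumr mulr_suml [RHS](reindex_inj (mulgI h)) /=; apply: eq_bigr => g _.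
by rewrite -[LHS]/(Ad (v h) (Ad (v g) x)) Ad_proj.
Qed.

Lemma average_const x y : (forall g, Ad (v g) x = y) -> average x = y.
Proof.
by move=> h; rewrite /average (eq_bigr (fun=> y)) // mean_const.
Qed.

Lemma average_fix x : commutant x -> average x = x.
Proof. by move=> /commutantP; apply: average_const. Qed.

Lemma average1 : average 1 = 1.
Proof. exact/average_fix/commutant1. Qed.

Lemma average_Ad g x : average (Ad (v g) x) = average x.
Proof.
rewrite /average; congr (_ *: _); rewrite [RHS](reindex_inj (mulIg g)).
by apply: eq_bigr => h _; rewrite Ad_proj.
Qed.

Lemma average_mull x y : commutant x -> average (x * y) = x * average y.
Proof.
move=> hx; rewrite /average -scalerAr mulr_sumr; congr (_ *: _).
by apply: eq_bigr => g _; rewrite /Ad mulrA hx !mulrA.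
Qed.

Lemma average_cp : cp_map average.
Proof.
apply: cp_scale; first by rewrite invr_ge0.
apply: cp_sum => g; rewrite /Ad; have := @cp_conj _ _ (star (v g)).
by rewrite starK.
Qed.

(** For these unitaries the average has the trace property [average (u x) = average (x u)]. They are
    closed under products, adjoints and phases. *)
Definition average_inv (u : A) : Prop := unitary u /\ forall x, average (Ad u x) = average x.

Lemma average_inv_proj g : average_inv (v g).
Proof. by split; [apply: proj_unitary | apply: average_Ad]. Qed.

Lemma average_invM u1 u2 : average_inv u1 -> average_inv u2 -> average_inv (u1 * u2).
Proof.
move=> [[a1 b1] h1] [[a2 b2] h2]; split=> [|x]; last by rewrite -Ad_mul h1 h2.
split; rewrite starM; first by rewrite mulrA -(mulrA _ _ u1) a1 mulr1.
by rewrite mulrA -(mulrA u1) b2 mulr1.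
Qed.

Lemma average_inv_star u : average_inv u -> average_inv (star u).
Proof.
move=> [[a b] h]; split=> [|x]; first by split; rewrite starK.
by rewrite -h Ad_mul b /Ad star1 mul1r mulr1.
Qed.

Lemma average_invZ (c : R[i]) u : `|c| = 1 -> average_inv u -> average_inv (c *: u).
Proof.
move=> c1 [[a b] h]; split=> [|x]; last by rewrite AdZ.
split; rewrite starZ -scalerAl -scalerAr scalerA ?a ?b; first by rewrite conj_unit ?scale1r.
by rewrite mulrC conj_unit ?scale1r.
Qed.

Lemma average_inv_comm u x : average_inv u -> average (u * x) = average (x * u).
Proof. by move=> [[a b] h]; rewrite -[RHS]h /Ad -!mulrA b mulr1. Qed.

End Commutant.

(** * A competing projection onto the commutant *)

Section InnerTwist.
Variables (R : realType) (G : finGroupType) (A : cstarAlgType R) (v : G -> A).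
Hypothesis proj_v : projective_representation v.
Variables u1 u2 : A.
Hypothesis inv1 : average_inv v u1.
Hypothesis inv2 : average_inv v u2.
Hypothesis u12 : average v u1 = average v u2.
Hypothesis u12s : average v (star u1) = average v (star u2).
Hypothesis comm1 : forall x, commutant v x -> u1 * x = x * u1.
Hypothesis comm2 : forall x, commutant v x -> u2 * x = x * u2.

Let quarter : R[i] := (4^-1 : R)%:C.

(** The opposite signs of [u1] and [u2] make their contributions at [x = 1] cancel when the averages
    agree, so that the map is unital. *)
Definition twisted (x : A) : A := quarter *:
  average v (star (1 + u1) * x * (1 + u1) + star (1 - u2) * x * (1 - u2)).

(* The average is a trace with respect to [u1] and [u2], which moves all the factors to the
   right. *)
Lemma twistedE x : let k := u1 + star u1 - (u2 + star u2) in
  twisted x = average v x + quarter *: average v (x * k).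
Proof.
move=> k.
have E u : average_inv v u -> average v (star (1 + u) * x * (1 + u)) =
    (average v x + average v x) + (average v (x * u) + average v (x * star u)).
  move=> hu; have hs := average_inv_star hu.
  rewrite starD star1 !mulrDl !mulrDr !mul1r !mulr1 !averageD.
  have -> : average v (star u * x * u) = average v x.
    by have [_ /(_ x) <-] := hs; rewrite /Ad starK.
  by rewrite (average_inv_comm _ hs) [X in _ + X]addrC addrACA.
have hN2 : average_inv v (- u2).
  by rewrite -scaleN1r; apply: average_invZ => //; rewrite normrN1.
rewrite /twisted averageD !E // addrACA starN !mulrN !averageN.
rewrite /k mulrBr !mulrDr !averageD averageN averageD opprD scalerDr; congr (_ + _).
have -> : average v x + average v x + (average v x + average v x) = (4 : R)%:C *: average v x.
  by rewrite -!mulr2n -mulrnA rmorph_nat scaler_nat.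
by rewrite scalerA -rmorphM mulVf ?pnatr_eq0 // scale1r.
Qed.

Lemma twisted1 : twisted 1 = 1.
Proof.
rewrite twistedE average1 // mul1r averageD averageN !averageD u12 u12s subrr.
by rewrite scaler0 addr0.
Qed.

Lemma twisted_linear (c : R[i]) x y : twisted (c *: x + y) = c *: twisted x + twisted y.
Proof.
rewrite !twistedE mulrDl -scalerAl !average_linear scalerDr !scalerDr.
by rewrite !scalerA [quarter * c]mulrC addrACA.
Qed.

Lemma twisted_cp : cp_map twisted.
Proof.
apply: cp_scale; first by rewrite invr_ge0.
apply: cp_comp; first exact: average_cp.
by apply: cp_add; apply: cp_conj.
Qed.

Lemma twisted_commutant x : commutant v (twisted x).
Proof.
have [_ [C0 Clin] _ _] := commutant_subalgebra proj_v.
rewrite /twisted -[X in commutant v X]addr0; apply: Clin => //.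
exact: average_commutant.
Qed.

(** Elements of the commutant commute with [u1], [u2] and their adjoints, so [x] factors out:
    [twisted x = x * twisted 1]. *)
Lemma twisted_fix x : commutant v x -> twisted x = x.
Proof.
move=> hx; have cs u : (forall x, commutant v x -> u * x = x * u) -> star u * x = x * star u.
  move=> hu; have [_ _ _ Cs] := commutant_subalgebra proj_v.
  by have := congr1 (@star R A) (hu _ (Cs _ hx)); rewrite !starM !starK.
have e (b : A) : star b * x = x * star b -> star b * x * b = x * (star b * 1 * b).
  by move=> ->; rewrite mulr1 mulrA.
rewrite -[RHS]mulr1 -twisted1 /twisted -scalerAr -average_mull // [in RHS]mulrDr !e //.
  by rewrite starB star1 mulrBl mulrBr mul1r mulr1 cs.
by rewrite starD star1 mulrDl mulrDr mul1r mulr1 cs.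
Qed.

(** Testing at the self-adjoint element [k] gives [average (k^2) = 0]. Up to a positive factor this
    is a sum of terms [b^* b] with [b = k v_g^*], so each [b] vanishes, and with it [k]. *)
Lemma twisted_eq_average : (forall x, twisted x = average v x) ->
  u1 + star u1 = u2 + star u2.
Proof.
move=> h; apply/eqP; rewrite -subr_eq0; apply/eqP; set k := _ - _.
have sk : star k = k by rewrite starB !starD !starK ![star _ + _]addrC.
have q0 : quarter != 0 by rewrite (inj_eq (@complexI R)) invr_eq0 pnatr_eq0.
have : average v (k * k) = 0.
  have := h k; rewrite twistedE -/k -[RHS]addr0 => /addrI /eqP.
  by rewrite scaler_eq0 (negbTE q0) => /eqP.
rewrite /average => /eqP; rewrite scaler_eq0 (inj_eq (@complexI R)) invr_eq0.
rewrite (negbTE (card_group_neq0 _ _)) /= => /eqP s0.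
have : \sum_g star (k * star (v g)) * (k * star (v g)) = 0.
  by rewrite -[RHS]s0; apply: eq_bigr => g _; rewrite /Ad starM starK sk !mulrA.
move=> /sum_star_mul_eq0/(_ 1%g) kv; have [e _] := proj_unitary proj_v 1%g.
by rewrite -[k]mulr1 -e mulrA kv mul0r.
Qed.

End InnerTwist.

(** * Unique pseudo-expectations for the inclusion of a commutant *)

Section UniquePseudoExpectation.
Variables (R : realType) (G : finGroupType) (A : cstarAlgType R) (v : G -> A).
Hypothesis proj_v : projective_representation v.
Variables (I : cstarAlgType R) (j : A -> I).
Hypothesis env : injective_envelope (commutant v) j.

Let hom_j : unital_star_hom_on (commutant v) j. Proof. by case: env. Qed.

Let cv1 : commutant v 1. Proof. exact: commutant1. Qed.

Let sub_v : cstar_subalgebra (commutant v). Proof. exact: commutant_subalgebra. Qed.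

Lemma pseudo_expectation_comp (Phi : A -> A) : cp_map Phi -> (forall x, commutant v (Phi x)) ->
  (forall (c : R[i]) x y, Phi (c *: x + y) = c *: Phi x + Phi y) ->
  (forall x, commutant v x -> Phi x = x) ->
  pseudo_expectation (commutant v) j (j \o Phi).
Proof.
move=> cpP CP linP fixP; split; last by move=> c Cc /=; rewrite fixP.
by apply: (ucp_star_hom_comp sub_v) => //; apply: fixP.
Qed.

Lemma unique_twisted_sum u1 u2 : unique_pseudo_expectation (commutant v) j ->
  average_inv v u1 -> average_inv v u2 -> average v u1 = average v u2 ->
  average v (star u1) = average v (star u2) ->
  (forall x, commutant v x -> u1 * x = x * u1) ->
  (forall x, commutant v x -> u2 * x = x * u2) ->
  u1 + star u1 = u2 + star u2.
Proof.
move=> [Psi [_ uniq]] i1 i2 e es c1 c2; apply: (twisted_eq_average proj_v i1 i2) => x.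
have pa : pseudo_expectation (commutant v) j (j \o average v).
  apply: pseudo_expectation_comp; [exact: average_cp | exact: average_commutant |
    exact: average_linear | exact: average_fix].
have pt : pseudo_expectation (commutant v) j (j \o twisted v u1 u2).
  apply: pseudo_expectation_comp; [exact: twisted_cp | exact: twisted_commutant | | ].
    exact: twisted_linear.
  exact: twisted_fix.
have jj : j (twisted v u1 u2 x) = j (average v x).
  by have /(congr1 (@^~ x)) := etrans (esym (uniq _ pt)) (uniq _ pa).
have [_ inj _ _] := env.
by apply: inj => //; rewrite inE; [apply: twisted_commutant | apply: average_commutant].
Qed.

Lemma unique_commute : unique_pseudo_expectation (commutant v) j ->
  forall g h, v g * v h = v h * v g.
Proof.
move=> uniq g h; apply/(Ad_eq _ _ (proj_unitary proj_v g)).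
set y := v h; set y' := Ad (v g) y.
(* [c = 1] compares the self-adjoint parts of [y] and [y'], [c = i] the skew-adjoint parts; together
   they give [2 y = 2 y']. *)
have key (c : R[i]) : `|c| = 1 -> c *: y + star (c *: y) = c *: y' + star (c *: y').
  move=> c1; have iy : average_inv v y by apply: average_inv_proj.
  have iy' : average_inv v y'.
    rewrite /y' /Ad; apply: average_invM; last by apply/average_inv_star/average_inv_proj.
    by apply: average_invM => //; apply: average_inv_proj.
  have cZ (z x : A) : z * x = x * z -> c *: z * x = x * (c *: z).
    by rewrite -scalerAl -scalerAr => ->.
  apply: unique_twisted_sum => //; try exact: average_invZ.
  - by rewrite !averageZ // /y' average_Ad.
  - rewrite !starZ !averageZ //; congr (_ *: _).
    have -> : star y' = Ad (v g) (star y) by rewrite /y' /Ad !starM starK mulrA.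
    by rewrite average_Ad.
  - by move=> x cx; apply: cZ; apply: cx.
  - move=> x cx; apply: cZ; rewrite /y' /Ad -mulrA commutant_star // mulrA.
    by rewrite -(mulrA (v g)) cx !mulrA cx.
have := key 1 (normr1 _); rewrite !scale1r => k1.
have i1 : `|'i%C : R[i]| = 1 by rewrite normc_def /= expr0n expr1n add0r sqrtr1.
have := key _ i1; rewrite !starZ conjCi !scaleNr -!scalerBr => /scalerI k2.
have i0 : 'i%C != 0 :> R[i] by rewrite -normr_eq0 i1 oner_eq0.
have := congr2 +%R k1 (k2 i0); rewrite ![_ + star _ + _]addrACA !addrN !addr0.
by move=> /(congr1 (fun x => (2^-1 : R)%:C *: x)); rewrite !half_double.
Qed.

Lemma commute_unique : (forall g h, v g * v h = v h * v g) ->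
  unique_pseudo_expectation (commutant v) j.
Proof.
move=> vv; have [[j1 jlin jM jS] inj [opI injI] minI] := env.
have Cv g : commutant v (v g) by move=> h; apply: vv.
have Cs x : commutant v x -> commutant v (star x) by case: sub_v => _ _ _; apply.
pose W g := j (v g).
have projW : projective_representation W.
  case: (proj_v) => _ [sigma cs e]; split=> [g|].
    have [a b] := proj_unitary proj_v g.
    by split; rewrite /W -jS // -jM ?a ?b //; apply: Cs.
  exists sigma => // g h; rewrite /W -jM // e.
  by apply: (linear_on_scale _ _ jlin) => //; case: sub_v => _ [].
(* Following an extension into [I] by the average over [W] gives one into the commutant of [W],
   which is therefore injective; by minimality it is all of [I], so each [W g] is central. *)
have SI : commutant W = [set: I].
  apply: minI; last first.
    by move=> _ [x Cx <-] g; rewrite /W -!jM // Cx.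
  split.
    by have [_ [C0 Clin] _ CS] := commutant_subalgebra projW; split=> //; apply: commutant1.
  move=> D E F opE opF EF f [f1 fS flin fcp].
  have [//|g0 [[g1 gS glin gcp] gE]] := injI D E F opE opF EF f.
  exists (average W \o g0); split; last first.
    by move=> x Ex /=; rewrite gE // average_fix //; apply: fS.
  split=> //=.
  - by rewrite g1 average1.
  - by move=> x _; apply: average_commutant.
  - by move=> c x y Fx Fy; rewrite glin // average_linear.
  - move=> n M FM pM; rewrite map_mx_comp; apply: cp_mxpositive; first exact: average_cp.
    exact: gcp.
exists (j \o average v); split.
  apply: pseudo_expectation_comp; [exact: average_cp | exact: average_commutant |
    exact: average_linear | exact: average_fix].
move=> Psi [ucpP fixP]; apply/funext => x /=.
rewrite -fixP; last exact: average_commutant.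
have [_ _ Plin _] := ucpP.
rewrite /average (linear_on_scale _ _ Plin) // (linear_on_sum _ _ Plin) //.
(* The multiplicative domain gives [Psi (Ad (v g) x) = Ad (W g) (Psi x)], and [W g] is central. *)
have PAd g : Psi (Ad (v g) x) = Psi x.
  have [a b] := proj_unitary projW g; have [a' b'] := proj_unitary proj_v g.
  have PW : Psi (v g) = W g by apply: fixP.
  have PsW : Psi (star (v g)) = star (W g) by rewrite fixP ?jS //; apply: Cs.
  have := @ucp_mult_domain _ _ _ Psi (star (v g)) (star (W g)) ucpP PsW.
  rewrite !starK => /(_ PW b' b) key.
  rewrite /Ad; have [_ ->] := key (v g * x); have [-> _] := key x.
  have : commutant W (Psi x) by rewrite SI.
  by move=> ->; rewrite -mulrA b mulr1.
by rewrite (eq_bigr (fun=> Psi x)) // mean_const.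
Qed.

Lemma unique_pseudo_expectation_commutant :
  unique_pseudo_expectation (commutant v) j <-> forall g h, v g * v h = v h * v g.
Proof. by split; [apply: unique_commute | apply: commute_unique]. Qed.

End UniquePseudoExpectation.

Lemma abelian_setT (G : finGroupType) :
  abelian [set: G]%SET <-> forall g h : G, (g * h = h * g)%g.
Proof.
split=> [/centsP ab g h|ab]; first by apply: ab; rewrite finset.in_setT.
by apply/centsP => g _ h _; apply: ab.
Qed.

(** * Matrix units and the regular representations *)

Section MatrixUnits.
Variables (R : realType) (G : finGroupType).
Implicit Types (a b c d g h k x y : G).

Local Notation E := (@Eunit R G).

Lemma mul_Eunit a b c d : E a b *m E c d = if b == c then E a d else 0.
Proof.
rewrite /Eunit mul_delta_mx_cond (inj_eq enum_rank_inj).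
by case: eqP; rewrite ?mulr1n ?mulr0n.
Qed.

Lemma star_Eunit a b : (map_mx Num.conj (E a b))^T = E b a.
Proof. by rewrite /Eunit map_delta_mx trmx_delta. Qed.

Lemma sum_Eunit_diag : \sum_x E x x = 1%:M :> Bl2 R G.
Proof.
apply/matrixP => i j; rewrite summxE !mxE.
rewrite (bigD1 (enum_val i)) //= big1 => [|x xi]; rewrite /Eunit mxE.
  by rewrite enum_valK eqxx addr0 eq_sym.
case: eqP => // ix; case/eqP: xi; rewrite ix enum_rankK //.
Qed.

(** Sends [delta_y] to [delta_(y k^-1)], which makes it multiplicative in [k]. *)
Definition right_regular k : Bl2 R G := \sum_x E x (x * k)%g.

Lemma Eunit_right a b k : E a b *m right_regular k = E a (b * k)%g.
Proof.
rewrite mulmx_sumr (bigD1 b) //= big1 => [|x xb]; rewrite mul_Eunit.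
  by rewrite eqxx addr0.
by rewrite eq_sym (negbTE xb).
Qed.

Lemma right_Eunit a b k : right_regular k *m E (a * k)%g b = E a b.
Proof.
rewrite mulmx_suml (bigD1 a) //= big1 => [|x xa]; rewrite mul_Eunit.
  by rewrite eqxx addr0.
by rewrite (inj_eq (mulIg k)) (negbTE xa).
Qed.

Lemma right_regularM k h : right_regular k *m right_regular h = right_regular (k * h)%g.
Proof.
rewrite {1}/right_regular mulmx_suml; apply: eq_bigr => x _.
by rewrite Eunit_right mulgA.
Qed.

Lemma right_regular1 : right_regular 1 = 1%:M.
Proof. by rewrite -sum_Eunit_diag; apply: eq_bigr => x _; rewrite mulg1. Qed.

Lemma star_right_regular k : (map_mx Num.conj (right_regular k))^T = right_regular k^-1.
Proof.
rewrite /right_regular map_mx_sum linear_sum [RHS](reindex_inj (mulIg k)) /=.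
by apply: eq_bigr => x _; rewrite star_Eunit mulgK.
Qed.

Lemma left_right_comm g k :
  left_regular R g *m right_regular k = right_regular k *m left_regular R g.
Proof.
rewrite /left_regular mulmx_suml mulmx_sumr [RHS](reindex_inj (mulIg k)) /=.
by apply: eq_bigr => x _; rewrite Eunit_right mulgA right_Eunit.
Qed.

Lemma left_Eunit g a b : left_regular R g *m E a b = E (g * a)%g b.
Proof.
rewrite mulmx_suml (bigD1 a) //= big1 => [|x xa]; rewrite mul_Eunit.
  by rewrite eqxx addr0.
by rewrite (negbTE xa).
Qed.

End MatrixUnits.

(** * The crossed product as a commutant *)

Section CrossedProduct.
Variables (R : realType) (G : finGroupType) (A : cstarAlgType R).
Variables (alpha : G -> A -> A) (w : G -> A) (D : cstarAlgType R) (t : A -> Bl2 R G -> D).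
Hypothesis proj_w : projective_representation w.
Hypothesis alphaE : forall g, alpha g =1 Ad (w g).
Hypothesis tensor_t : tensor_Bl2 t.
Implicit Types (a b : A) (x y : Bl2 R G) (g h k p q : G).

Local Notation E := (@Eunit R G).
Local Notation rho := (@right_regular R G).

Lemma tensorDl a b x : t (a + b) x = t a x + t b x.
Proof. by have [+ _ _ _] := tensor_t => /(_ 1 a b x); rewrite !scale1r. Qed.

Lemma tensorDr a x y : t a (x + y) = t a x + t a y.
Proof. by have [_ + _ _] := tensor_t => /(_ 1 a x y); rewrite !scale1r. Qed.

Lemma tensor0l x : t 0 x = 0.
Proof. by apply: (addrI (t 0 x)); rewrite -tensorDl !addr0. Qed.

Lemma tensor0r a : t a 0 = 0.
Proof. by apply: (addrI (t a 0)); rewrite -tensorDr !addr0. Qed.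

Lemma tensorZl (c : R[i]) a x : t (c *: a) x = c *: t a x.
Proof.
by have [+ _ _ _] := tensor_t => /(_ c a 0 x); rewrite addr0 tensor0l addr0.
Qed.

Lemma tensor_sumr (K : finType) a (x : K -> Bl2 R G) :
  t a (\sum_i x i) = \sum_i t a (x i).
Proof. by rewrite (big_morph (t a) (tensorDr a) (tensor0r a)). Qed.

Lemma tensorM a b x y : t a x * t b y = t (a * b) (x *m y).
Proof. by case: tensor_t. Qed.

Lemma tensor_star a x : star (t a x) = t (star a) (map_mx Num.conj x)^T.
Proof. by case: tensor_t => _ _ _ []. Qed.

Lemma tensor1 : t 1 1%:M = 1.
Proof. by case: tensor_t => _ _ _ []. Qed.

Lemma tensor_coefP (d : D) : exists c : G -> G -> A, d = \sum_p \sum_q t (c p q) (E p q).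
Proof.
have [_ _ _ [_ _ /(_ d)[c [dE _]]]] := tensor_t.
by exists (fun p q => c (p, q)); rewrite pair_bigA dE; apply: eq_bigr => -[].
Qed.

Lemma tensor_coef_inj (c1 c2 : G -> G -> A) :
  \sum_p \sum_q t (c1 p q) (E p q) = \sum_p \sum_q t (c2 p q) (E p q) ->
  forall p q, c1 p q = c2 p q.
Proof.
move=> e p q; have [_ _ _ [_ _ /(_ (\sum_p \sum_q t (c1 p q) (E p q)))[c [_ cU]]]] := tensor_t.
have /ffunP/(_ (p, q)) : [ffun pq => c1 pq.1 pq.2] = [ffun pq => c2 pq.1 pq.2].
  transitivity c; [apply: esym|]; apply: cU; [|rewrite e];
    by rewrite pair_bigA; apply: eq_bigr => pq _; rewrite ffunE.
by rewrite !ffunE.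
Qed.

Lemma tensor_right_regular a k :
  t a (rho k) = \sum_p \sum_q t (if q == (p * k)%g then a else 0) (E p q).
Proof.
rewrite tensor_sumr; apply: eq_bigr => p _.
rewrite (bigD1 (p * k)%g) //= eqxx big1 ?addr0 // => q qp.
by rewrite (negbTE qp) tensor0l.
Qed.

Definition dual_rep k : D := t (w k) (rho k).

Lemma dual_projective : projective_representation dual_rep.
Proof.
have [uw [sigma cs e]] := proj_w; split=> [k|].
  have [a b] := uw k; rewrite /unitary /dual_rep tensor_star star_right_regular.
  by rewrite !tensorM !right_regularM mulVg mulgV right_regular1 a b tensor1.
exists sigma => // g h.
by rewrite /dual_rep tensorM right_regularM e tensorZl.
Qed.

Lemma unitary_neq0 (u : A) : unitary u -> u != 0.
Proof.
by move=> [e _]; apply/eqP => u0; move/eqP: e; rewrite u0 mulr0 eq_sym oner_eq0.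
Qed.

Lemma proj_mul_neq0 g h : w g * w h != 0.
Proof.
have [a _] := proj_unitary proj_w g; have h0 := unitary_neq0 (proj_unitary proj_w h).
by apply: contra_neq h0 => e; rewrite -[w h]mul1r -a -mulrA e mulr0.
Qed.

(** At the matrix unit [E 1 (g h)], one product has the coefficient [w_g w_h], which is nonzero; the
    other has [w_h w_g] if [g h = h g], and 0 otherwise. *)
Lemma dual_rep_commute : (forall g h, dual_rep g * dual_rep h = dual_rep h * dual_rep g) <->
  abelian [set: G]%SET /\ forall g h, w g * w h = w h * w g.
Proof.
rewrite abelian_setT; split=> [vv|[ab ww] g h]; last first.
  by rewrite /dual_rep !tensorM !right_regularM ww ab.
have key g h : (g * h)%g = (h * g)%g /\ w g * w h = w h * w g.
  have := vv g h; rewrite /dual_rep !tensorM !right_regularM !tensor_right_regular.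
  move=> /tensor_coef_inj/(_ 1%g (g * h)%g); rewrite !mul1g eqxx.
  case: eqP => [//|_] /eqP.
  by rewrite (negbTE (proj_mul_neq0 _ _)).
by split=> g h; case: (key g h).
Qed.

Lemma alphaV q a : alpha q^-1 a = star (w q) * a * w q.
Proof.
have [uw _] := proj_w; have [a1 a2] := uw q.
have <- : Ad (star (w q)) a = star (w q) * a * w q by rewrite /Ad starK.
rewrite alphaE -{2}(Ad_proj1 proj_w a) -(mulgV q) -Ad_proj //.
by rewrite (Ad_star _ (proj_unitary proj_w q)).
Qed.

(** The generators commute with [dual_rep]. Conversely, an element of the commutant is determined by
    its coefficients [c s 1] in the column of 1: it is the sum over [s] of [1 (x) lambda_s] times
    the embedded copy of [c s 1]. *)
Lemma crossed_product_commutant : crossed_product alpha t = commutant dual_rep.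
Proof.
apply/seteqP; split=> [d|d dC].
  apply; first exact/commutant_subalgebra/dual_projective.
  move=> _ [[a _ <-]|[g _ <-]] k; last first.
    by rewrite /dual_rep !tensorM mulr1 mul1r left_right_comm.
  rewrite mulr_sumr mulr_suml (reindex_inj (mulIg k)) /=; apply: eq_bigr => x _.
  rewrite /dual_rep !tensorM right_Eunit Eunit_right; congr (t _ _).
  have [_ u2] := proj_unitary proj_w k.
  have -> : alpha (x * k)^-1%g a = alpha k^-1%g (alpha x^-1%g a).
    by rewrite invMg !alphaE Ad_proj.
  by rewrite [in LHS]alphaV !mulrA u2 mul1r.
move=> S [Scl [S0 Slin] SM SS] genS.
have [c dE] := tensor_coefP d.
(* Compares the coefficients at [(p q^-1, q)] of the two products of [d] with [dual_rep q]. *)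
have cE p q : c p q = alpha q^-1%g (c (p * q^-1)%g 1%g).
  have vd : dual_rep q * d = \sum_x \sum_y t (w q * c (x * q)%g y) (E x y).
    rewrite dE mulr_sumr (reindex_inj (mulIg q)) /=; apply: eq_bigr => x _.
    by rewrite mulr_sumr; apply: eq_bigr => y _; rewrite tensorM right_Eunit.
  have dv : d * dual_rep q = \sum_x \sum_y t (c x (y * q^-1)%g * w q) (E x y).
    rewrite dE mulr_suml; apply: eq_bigr => x _.
    rewrite mulr_suml [RHS](reindex_inj (mulIg q)) /=; apply: eq_bigr => y _.
    by rewrite tensorM Eunit_right mulgK.
  have := dC q; rewrite vd dv => /tensor_coef_inj/(_ (p * q^-1)%g q).
  rewrite mulgKV mulgV alphaV => e; have [u1 _] := proj_unitary proj_w q.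
  by rewrite -mulrA -e mulrA u1 mul1r.
have -> : d = \sum_s t 1 (left_regular R s) *
    \sum_(g : G) t (alpha g^-1%g (c s 1%g)) (E g g).
  under eq_bigr do rewrite mulr_sumr; rewrite dE exchange_big [RHS]exchange_big.
  apply: eq_bigr => q _ /=; rewrite (reindex_inj (mulIg q)) /=; apply: eq_bigr => s _.
  by rewrite tensorM mul1r left_Eunit cE mulgK.
have SD (x y : D) : S x -> S y -> S (x + y).
  by move=> Sx Sy; have := Slin 1 x y Sx Sy; rewrite scale1r.
apply: big_ind => // s _; apply: SM; apply: genS; [by right; exists s | left].
by exists (c s 1%g).
Qed.

End CrossedProduct.

(** * From commuting projective representations to genuine ones *)

Section Linearization.
Variables (R : realType) (G : finGroupType).
Variable sigma : G -> G -> R[i].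
Hypothesis cocycle_sigma : circle_cocycle sigma.

(** The left regular representation twisted by [sigma]; it realizes the cocycle in finite dimension,
    where eigenvectors exist. *)
Definition twisted_regular (g : G) : Bl2 R G :=
  \sum_h sigma g h *: Eunit R (g * h)%g h.

Lemma twisted_regularM g h :
  twisted_regular g *m twisted_regular h = sigma g h *: twisted_regular (g * h)%g.
Proof.
rewrite /twisted_regular mulmx_sumr scaler_sumr; apply: eq_bigr => y _.
rewrite -scalemxAr mulmx_suml (bigD1 (h * y)%g) //= big1 => [|x xhy].
  rewrite -scalemxAl mul_Eunit eqxx addr0 !scalerA mulgA; congr (_ *: _).
  by have [_ ->] := cocycle_sigma; rewrite mulrC.
by rewrite -scalemxAl mul_Eunit (negbTE xhy) scaler0.
Qed.

Lemma twisted_regular1 : twisted_regular 1%g = sigma 1%g 1%g *: 1%:M.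
Proof.
rewrite -sum_Eunit_diag scaler_sumr; apply: eq_bigr => y _; rewrite mul1g; congr (_ *: _).
(* The cocycle identity at [(1, 1, y)] gives [sigma 1 y = sigma 1 1]. *)
have [s1 sc] := cocycle_sigma; have := sc 1%g 1%g y; rewrite mul1g mul1g.
have s0 : sigma 1%g y != 0 by rewrite -normr_eq0 s1 oner_eq0.
by move/(mulIf s0).
Qed.

(* The eigenvalues on a common eigenvector of the (commuting) twisted regular representation. *)
Lemma symmetric_cocycle_trivial : abelian [set: G]%SET ->
  (forall g h, sigma g h = sigma h g) ->
  exists chi : G -> R[i], (forall g, `|chi g| = 1) /\
    forall g h, chi g * chi h = sigma g h * chi (g * h)%g.
Proof.
move=> /abelian_setT ab sym; have [s1 _] := cocycle_sigma.
have G0 : (0 < #|G|)%N by apply/card_gt0P; exists 1%g.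
have [v v0 /allP stab] : exists2 v : 'rV[R[i]]_#|G|, v != 0 &
    all (fun T => stablemx v T) [seq twisted_regular g | g <- enum G].
  apply: common_eigenvector => // _ _ /mapP[g _ ->] /mapP[h _ ->].
  by rewrite /comm_mx !twisted_regularM sym ab.
have /choice[chi chiP] : forall g, exists c, v *m twisted_regular g = c *: v.
  move=> g; apply/sub_rVP; apply: stab.
  by apply/mapP; exists g => //; rewrite mem_enum.
have scI (a b : R[i]) : a *: v = b *: v -> a = b.
  move=> /eqP; rewrite -subr_eq0 -scalerBl scaler_eq0 (negbTE v0) orbF subr_eq0.
  by move=> /eqP.
have chiM g h : chi g * chi h = sigma g h * chi (g * h)%g.
  apply: scI; rewrite -[in RHS]scalerA -chiP scalemxAr -twisted_regularM mulmxA.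
  by rewrite chiP -scalemxAl chiP scalerA.
exists chi; split=> // g.
(* [|chi|] is multiplicative and [g] has finite order, so a power of [|chi g|] is 1. *)
have nM a b : `|chi (a * b)%g| = `|chi a| * `|chi b|.
  by rewrite -normrM chiM normrM s1 mul1r.
have n1 : `|chi 1%g| = 1.
  have -> : chi 1%g = sigma 1%g 1%g; last exact: s1.
  by apply: scI; rewrite -chiP twisted_regular1 -scalemxAr mulmx1.
have nX m : `|chi (g ^+ m)%g| = `|chi g| ^+ m.
  by elim: m => [|m IH]; rewrite ?expg0 // expgS nM IH exprS.
apply/eqP; rewrite -(@pexpr_eq1 _ _ #[g]%g) ?normr_ge0 ?order_gt0 //.
by rewrite -nX expg_order n1.
Qed.

End Linearization.

(** Commuting [w_g] make the cocycle symmetric, and dividing by a [chi] that trivializes it gives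
    [u]. Conversely, [star (u g) * w g] is central because both unitaries implement [alpha g]; so
    [w_g] is [u_g] times a central factor, and the [u_g] commute. *)
Lemma commuting_linearization (R : realType) (G : finGroupType) (A : cstarAlgType R)
    (alpha : G -> A -> A) (w : G -> A) :
  projective_representation w -> (forall g, alpha g =1 Ad (w g)) -> abelian [set: G]%SET ->
  (forall g h, w g * w h = w h * w g) <->
  exists u : G -> A, unitary_representation u /\ forall g, alpha g =1 Ad (u g).
Proof.
move=> pw aE abG; have ab := (abelian_setT G).1 abG; split=> [ww|[u [[uu uM] aU]] g h].
  have [uw [sigma cs e]] := pw.
  have sym g h : sigma g h = sigma h g.
    have := ww g h; rewrite !e (ab h g) => /eqP; rewrite -subr_eq0 -scalerBl scaler_eq0.
    by rewrite (negbTE (unitary_neq0 (uw _))) orbF subr_eq0 => /eqP.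
  have [chi [n1 chiM]] := symmetric_cocycle_trivial cs abG sym.
  have nV g : `|(chi g)^-1| = 1 by rewrite normfV n1 invr1.
  have chi0 g : chi g != 0 by rewrite -normr_eq0 n1 oner_eq0.
  exists (fun g => (chi g)^-1 *: w g); split; last by move=> g x; rewrite AdZ // aE.
  split=> [g|g h].
    have [a b] := uw g; split; rewrite starZ -scalerAl -scalerAr scalerA ?a ?b.
      by rewrite conj_unit ?scale1r.
    by rewrite mulrC conj_unit ?scale1r.
  rewrite -scalerAl -scalerAr e !scalerA; congr (_ *: _).
  have s0 : sigma g h != 0 by rewrite -normr_eq0; have [-> _] := cs; rewrite oner_eq0.
  by rewrite -invfM chiM invfM mulrAC mulVf // mul1r.
have uw g' x : star (u g') * w g' * x = x * (star (u g') * w g').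
  have [a b] := uu g'; have [c d] := proj_unitary pw g'.
  have e : w g' * x * star (w g') = u g' * x * star (u g') by rewrite -[LHS]aE aU.
  rewrite -[LHS]mulr1 -c -!mulrA (mulrA (w g')) (mulrA (w g' * x)) e.
  by rewrite !mulrA a mul1r.
have wE g' : w g' = u g' * (star (u g') * w g') by rewrite mulrA (uu g').2 mul1r.
rewrite (wE g) (wE h); set z := star (u g) * w g; set z' := star (u h) * w h.
have mul_central (a b c d : A) : (forall x, c * x = x * c) -> a * c * (b * d) = a * b * (c * d).
  by move=> cc; rewrite !mulrA -(mulrA a c) cc !mulrA.
by rewrite (mul_central _ _ _ _ (uw g)) (mul_central _ _ _ _ (uw h)) -!uM ab uw.
Qed.

(** * The fixed-point algebra and the crossed product *)

(* (IF, jF) and (IX, jX) are the injective envelopes of A^G and of the crossed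
   product; D, with elementary tensors t, is A (x) B(l^2(G)). *)
Theorem theorem3p28 (R : realType) (G : finGroupType) (A : cstarAlgType R)
    (alpha : G -> A -> A) (w : G -> A)
    (D : cstarAlgType R) (t : A -> Bl2 R G -> D)
    (IF : cstarAlgType R) (jF : A -> IF)
    (IX : cstarAlgType R) (jX : D -> IX) :
  simple_cstar A ->
  is_action alpha ->
  inner_action alpha ->
  projective_representation w ->
  (forall g, alpha g =1 Ad (w g)) ->
  tensor_Bl2 t ->
  injective_envelope (fixed_points alpha) jF ->
  injective_envelope (crossed_product alpha t) jX ->
  [/\ unique_pseudo_expectation (fixed_points alpha) jF <->
        (forall g h, w g * w h = w h * w g),
      (unique_pseudo_expectation (crossed_product alpha t) jX <->
         abelian [set: G]%SET /\ (forall g h, w g * w h = w h * w g)) /\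
      (abelian [set: G]%SET /\ (forall g h, w g * w h = w h * w g) <->
         abelian [set: G]%SET /\
         exists u : G -> A,
           unitary_representation u /\ (forall g, alpha g =1 Ad (u g))) &
      unique_pseudo_expectation (crossed_product alpha t) jX ->
        unique_pseudo_expectation (fixed_points alpha) jF].
Proof.
move=> _ _ _ pw aE tt envF envX.
have fixE : fixed_points alpha = commutant w.
  apply/seteqP; split=> x hx; first by apply/(commutantP pw) => g; rewrite -aE.
  by move=> g; rewrite aE; apply: (commutantP pw _).1.
move: envF envX; rewrite fixE (crossed_product_commutant pw aE tt) => envF envX.
have uF := unique_pseudo_expectation_commutant pw envF.
have uX := unique_pseudo_expectation_commutant (dual_projective pw tt) envX.
have uD := iff_trans uX (dual_rep_commute pw tt).
(* The condition for the crossed product contains the one for the fixed-point algebra. *)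
split=> //; last by move=> /uD[_ ww]; apply/uF.
split=> //; split=> -[ab h]; split=> //; exact/(commuting_linearization pw aE ab).
Qed.
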